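(* Let $E$ be a matrix base ordered space with matrix convex set $K$ and base function $f_1$, and let $\|\cdot\|_n$ be the expressions defined on $M_n(E)$ as in the context. Then the $\|\cdot\|_n$ are matrix norms with respect to which $E$ is an operator space and a matrix ordered matrix normed $*$-vector space, and $K$ lies in the positive part of the matrix unit ball of $E$. Also, $f_1$ is (completely) contractive on $E$, and $\| x \|_n = \| f_1^{(n)}(x) \|$ for $x \in M_n(E)_+$. Indeed $E$ satisfies all of the conditions to be a nc base norm space except possibly for $M_n(E)_+$ and $K_n$ being closed in the norm topology for $n \in \mathbb{N}$.
   Context: $\mathbb{F}=\mathbb{R}$ or $\mathbb{C}$. A matrix ordered space is a $*$-vector space $E$ with proper cones $M_n(E)_+ \subset M_n(E)_{\rm sa}$ such that $\alpha^* M_n(E)_+ \alpha \subset M_m(E)_+$ for all $\alpha \in M_{n,m}(\mathbb{F})$. A matrix convex set $K=(K_n)$, $K_n\subset M_n(E)$, is closed under direct sums and under compressions $x\mapsto a^*xa$ with $a^*a=I$. $E$ (with such $K$) is a matrix base ordered space if: (a) there is a strictly positive selfadjoint scalar functional $f_1$ on $E$ (the base function) with $K_n = M_n(E)_+ \cap \{x \in M_n(E): f_1^{(n)}(x) = I_n\}$; (b) for every $n$ and $x \in M_n(E)_{\rm sa}$ there exist $t>0$ and $k \in K_n$ with $x \le tk$; (c) if $x \in M_n(E)_{\rm sa}$ and for every $\epsilon>0$ one can write $x=y-z$ with $y,z\in M_n(E)_+$ and $\|f_1^{(n)}(y)\|,\|f_1^{(n)}(z)\|<\epsilon$, then $x=0$.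 The norms are defined by $\|x\|_n = \inf\{\|f_1^{(n)}(y+z)\| : x=y-z,\ y,z\in M_n(E)_+\}$ for $x\in M_n(E)_{\rm sa}$, and for general $x\in M_n(E)$ by $\|x\|_n = \left\|\begin{bmatrix} 0 & x\\ x^* & 0\end{bmatrix}\right\|_{2n}$. A matrix ordered matrix normed $*$-vector space is a matrix ordered space with a norm at each matrix level, closed matrix cones, and $\|x^*\|_n=\|x\|_n$. A nc base norm space is such a space $E$ which is also an operator space, with a matrix convex set $K$ such that: 1) $K_n \subset {\rm Ball}(M_n(E))_+$; 2) each $K_n$ is closed; 3) for every $t>1$ every element of ${\rm Ball}(M_n(E))_{\rm sa}$ has the form $c_1x_1c_1 - c_2x_2c_2$ with $c_i$ positive matrices, $c_1^2+c_2^2\le tI$, $x_i\in K_n$; 4) $K_n = M_n(E)_+\cap\{x: f_1^{(n)}(x)=I_n\}$ for a fixed positive (selfadjoint in the real case) scalar functional $f_1$. *)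

(* Defs.v *)
From HB Require Import structures.
From mathcomp Require Import all_boot all_order all_algebra.
From mathcomp Require Import boolp classical_sets reals.
From mathcomp Require Import complex.
Set Implicit Arguments. Unset Strict Implicit. Unset Printing Implicit Defensive.
Import Order.TTheory GRing.Theory Num.Theory.
Local Open Scope ring_scope.

Record scalars (R : realType) := Scalars {
  sc_ty :> numFieldType;
  sc_conj : sc_ty -> sc_ty;
  sc_ofR : R -> sc_ty;
  sc_re : sc_ty -> R }.

Definition realScalars (R : realType) : scalars R :=
  @Scalars R R id id id.

Definition complexScalars (R : realType) : scalars R :=
  @Scalars R (R[i]) (fun z => Num.conj z) (fun r => (r%:C)%C) (@complex.Re R).

Definition is_RC (R : realType) (F : scalars R) : Prop :=
  F = realScalars R \/ F = complexScalars R.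

Section Defs.
Variables (R : realType) (F : scalars R).

Definition absF (a : F) : R := Num.sqrt (sc_re (sc_conj a * a)).

Definition madj m n (a : 'M[F]_(m, n)) : 'M[F]_(n, m) :=
  (map_mx (@sc_conj R F) a)^T.

Definition vnorm n (v : 'cV[F]_n) : R :=
  Num.sqrt (\sum_(i < n) sc_re (sc_conj (v i 0) * v i 0)).

Definition opnorm m n (a : 'M[F]_(m, n)) : R :=
  sup [set vnorm (a *m v) | v in [set v : 'cV[F]_n | vnorm v <= 1]].

Definition psd n (c : 'M[F]_n) : Prop :=
  madj c = c /\ forall v : 'cV[F]_n, 0 <= (madj v *m c *m v) 0 0.

Variables (E : lmodType F) (star : E -> E).

Definition mstar m n (x : 'M[E]_(m, n)) : 'M[E]_(n, m) :=
  \matrix_(i, j) star (x j i).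

Definition selfadj n (x : 'M[E]_n) : Prop := mstar x = x.

Definition mscale m n (a : F) (x : 'M[E]_(m, n)) : 'M[E]_(m, n) :=
  map_mx (fun e => a *: e) x.

Definition mxEmul k m n p (a : 'M[F]_(k, m)) (x : 'M[E]_(m, n))
  (b : 'M[F]_(n, p)) : 'M[E]_(k, p) :=
  \matrix_(r, s) \sum_(i < m) \sum_(j < n) (a r i * b j s) *: x i j.

Definition ampl m n (f : E -> F) (x : 'M[E]_(m, n)) : 'M[F]_(m, n) :=
  map_mx f x.

Definition sanorm (C : forall n, set 'M[E]_n) (f : E -> F) n
    (x : 'M[E]_n) : R :=
  inf [set opnorm (ampl f (yz.1 + yz.2)) | yz in
        [set yz : 'M[E]_n * 'M[E]_n |
          [/\ x = yz.1 - yz.2, C n yz.1 & C n yz.2]]].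

Definition mnorm (C : forall n, set 'M[E]_n) (f : E -> F) n
    (x : 'M[E]_n) : R :=
  if `[< selfadj x >] then sanorm C f x
  else sanorm C f (block_mx 0 x (mstar x) 0).

End Defs.

(* Main.v *)
Require Import Defs.
From HB Require Import structures.
From mathcomp Require Import all_boot all_order all_algebra.
From mathcomp Require Import boolp classical_sets reals.
From mathcomp Require Import complex.
From mathcomp Require Import spectral sesquilinear ring lra.
Import Order.TTheory GRing.Theory Num.Theory.
Local Open Scope ring_scope.
Set Implicit Arguments. Unset Strict Implicit. Unset Printing Implicit Defensive.

(** For a selfadjoint [x] the norm is governed by quadratic forms: it is the
    infimum of the [c] for which [x = y - z] with [y, z >= 0] and
    [f(y + z) <= c I]. Hence, if [a^* a + b^* b <= k I], then
    [‖a^* x a + b^* y b‖ <= k max(‖x‖, ‖y‖)]; homogeneity, Ruan's axioms and the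
    agreement of the two formulas for the norm of a selfadjoint element are
    instances of this estimate, applied to [0 x; x^* 0]. Definiteness is
    hypothesis (c). For the decomposition of the selfadjoint unit ball, perturb
    [x = y - z] by a small multiple of some [k] in [K_n], added to both [y] and
    [z], so that [f(y)] is positive definite, and write [y = c (c^-1 y c^-1) c]
    with [c] the square root of [f(y)]; likewise for [z]. Over the reals this
    square root comes from the complex one, which is invariant under conjugation
    by uniqueness. *)

(** * Scalar arithmetic common to the real and complex cases *)

Lemma complex_conjE (R : realType) (z : R[i]) : Num.conj z = (conjc z)%C.
Proof. by []. Qed.

Section Scalars.
Variables (R : realType) (F : scalars R).
Hypothesis hF : is_RC F.
Implicit Types (a b : F) (s t : R).
Local Notation conj := (@sc_conj R F).
Local Notation re := (@sc_re R F).
Local Notation ofR := (@sc_ofR R F).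

Definition abs2 a : R := re (conj a * a).

Lemma conjFD a b : conj (a + b) = conj a + conj b.
Proof. by case: hF a b => -> a b //=; rewrite rmorphD. Qed.

Lemma conjFM a b : conj (a * b) = conj a * conj b.
Proof. by case: hF a b => -> a b //=; rewrite rmorphM. Qed.

Lemma conjFK a : conj (conj a) = a.
Proof. by case: hF a => -> a //=; rewrite conjCK. Qed.

Lemma conjF0 : conj 0 = 0.
Proof. by case: hF => -> //=; rewrite rmorph0. Qed.

Lemma conjF1 : conj 1 = 1.
Proof. by case: hF => -> //=; rewrite rmorph1. Qed.

Lemma conjF_sum I (r : seq I) (P : pred I) (f : I -> F) :
  conj (\sum_(i <- r | P i) f i) = \sum_(i <- r | P i) conj (f i).
Proof. exact: (big_morph conj conjFD conjF0). Qed.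

Lemma conjF_ofR t : conj (ofR t) = ofR t.
Proof. by case: hF => -> //=; rewrite complex_conjE conjc_real. Qed.

Lemma reFD a b : re (a + b) = re a + re b.
Proof. by case: hF a b => -> a b //=; case: a b => [? ?] [? ?]. Qed.

Lemma reFN a : re (- a) = - re a.
Proof. by case: hF a => -> a //=; case: a. Qed.

Lemma reF0 : re 0 = 0.
Proof. by case: hF => ->. Qed.

Lemma reF_sum I (r : seq I) (P : pred I) (f : I -> F) :
  re (\sum_(i <- r | P i) f i) = \sum_(i <- r | P i) re (f i).
Proof. exact: (big_morph re reFD reF0). Qed.

Lemma reF_conj a : re (conj a) = re a.
Proof. by case: hF a => -> a //=; case: a. Qed.

Lemma reF_ofR t : re (ofR t) = t.
Proof. by case: hF => ->. Qed.

Lemma reF_ofRM t a : re (ofR t * a) = t * re a.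
Proof. by case: hF a => -> a //=; case: a => x y /=; rewrite mul0r subr0. Qed.

Lemma ofRD s t : ofR (s + t) = ofR s + ofR t.
Proof. by case: hF => -> //=; rewrite rmorphD. Qed.

Lemma ofRM s t : ofR (s * t) = ofR s * ofR t.
Proof. by case: hF => -> //=; rewrite rmorphM. Qed.

Lemma ofR1 : ofR 1 = 1.
Proof. by case: hF => ->. Qed.

Lemma ofR_re a : conj a = a -> ofR (re a) = a.
Proof.
case: hF a => -> a //=; case: a => x y /=; rewrite complex_conjE => -[] h.
congr (_ +i* _)%C; lra.
Qed.

Lemma conjFMl a : conj a * a = ofR (abs2 a).
Proof. by rewrite /abs2 ofR_re // conjFM conjFK mulrC. Qed.

Lemma abs2_ge0 a : 0 <= abs2 a.
Proof.
rewrite /abs2; case: hF a => -> a /=; first by rewrite -expr2 sqr_ge0.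
case: a => x y /=; rewrite mulNr opprK; apply: addr_ge0; exact: sqr_ge0.
Qed.

Lemma abs2_eq0 a : abs2 a = 0 -> a = 0.
Proof.
move=> h; have := conjFMl a; rewrite h.
have -> : ofR 0 = 0 by case: hF => ->.
by move=> /eqP; rewrite mulf_eq0 => /orP[/eqP e|/eqP//]; rewrite -(conjFK a) e conjF0.
Qed.

Lemma abs2M a b : abs2 (a * b) = abs2 a * abs2 b.
Proof.
by rewrite {1}/abs2 conjFM mulrACA conjFMl reF_ofRM.
Qed.

Lemma abs2_ofR t : abs2 (ofR t) = t ^+ 2.
Proof. by rewrite /abs2 conjF_ofR reF_ofRM reF_ofR expr2. Qed.

Lemma reF_gt0 a : 0 < a -> 0 < re a.
Proof. by case: hF a => -> a //=; case: a => x y; rewrite ltcE /= => /andP[]. Qed.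

(** The order on [R[i]] only relates numbers with equal imaginary parts, so self-conjugacy is what
    lets a nonnegative real part suffice. *)
Lemma geF0 a : conj a = a -> 0 <= re a -> 0 <= a.
Proof.
case: hF a => -> a //=; case: a => x y /=; rewrite complex_conjE => -[] h h2.
by rewrite lecE /= h2 andbT; apply/eqP; lra.
Qed.

Lemma madjM m n p (a : 'M[F]_(m, n)) (b : 'M[F]_(n, p)) :
  madj (a *m b) = madj b *m madj a.
Proof.
apply/matrixP => i j; rewrite !mxE conjF_sum; apply: eq_bigr => k _.
by rewrite !mxE conjFM mulrC.
Qed.

Lemma madjK m n (a : 'M[F]_(m, n)) : madj (madj a) = a.
Proof. by apply/matrixP => i j; rewrite !mxE conjFK. Qed.

Lemma madjD m n (a b : 'M[F]_(m, n)) : madj (a + b) = madj a + madj b.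
Proof. by apply/matrixP => i j; rewrite !mxE conjFD. Qed.

Lemma madjZ m n t (b : 'M[F]_(m, n)) : madj (ofR t *: b) = ofR t *: madj b.
Proof. by apply/matrixP => i j; rewrite !mxE conjFM conjF_ofR. Qed.

Lemma conjFN a : conj (- a) = - conj a.
Proof. by case: hF a => -> a //=; rewrite rmorphN. Qed.

Lemma madjN m n (a : 'M[F]_(m, n)) : madj (- a) = - madj a.
Proof. by apply/matrixP => i j; rewrite !mxE conjFN. Qed.

Lemma madj0 m n : madj (0 : 'M[F]_(m, n)) = 0.
Proof. by apply/matrixP => i j; rewrite !mxE conjF0. Qed.

Lemma madj1 n : madj (1%:M : 'M[F]_n) = 1%:M.
Proof.
apply/matrixP => i j; rewrite !mxE eq_sym.
by case: eqP => _; rewrite ?conjF1 ?conjF0.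
Qed.

Lemma madj_block m1 m2 n1 n2 (a : 'M[F]_(m1, n1)) (b : 'M[F]_(m1, n2))
    (c : 'M[F]_(m2, n1)) (d : 'M[F]_(m2, n2)) :
  madj (block_mx a b c d) = block_mx (madj a) (madj c) (madj b) (madj d).
Proof. by rewrite /madj map_block_mx tr_block_mx. Qed.

Lemma madj_row m n1 n2 (a : 'M[F]_(m, n1)) (b : 'M[F]_(m, n2)) :
  madj (row_mx a b) = col_mx (madj a) (madj b).
Proof. by rewrite /madj map_row_mx tr_row_mx. Qed.

Lemma madj_col m1 m2 n (a : 'M[F]_(m1, n)) (b : 'M[F]_(m2, n)) :
  madj (col_mx a b) = row_mx (madj a) (madj b).
Proof. by rewrite /madj map_col_mx tr_col_mx. Qed.

(** * The underlying real inner product *)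

(** Taking real parts gives a symmetric real bilinear form over both fields. Nothing is lost on
    quadratic forms of selfadjoint matrices, which are real anyway. *)
Definition ip n (u v : 'cV[F]_n) : R := re ((madj u *m v) 0 0).

Lemma ipDl n (u v w : 'cV[F]_n) : ip (u + v) w = ip u w + ip v w.
Proof. by rewrite /ip madjD mulmxDl mxE reFD. Qed.

Lemma ipDr n (u v w : 'cV[F]_n) : ip u (v + w) = ip u v + ip u w.
Proof. by rewrite /ip mulmxDr mxE reFD. Qed.

Lemma ipNl n (u v : 'cV[F]_n) : ip (- u) v = - ip u v.
Proof. by rewrite /ip madjN mulNmx mxE reFN. Qed.

Lemma ipNr n (u v : 'cV[F]_n) : ip u (- v) = - ip u v.
Proof. by rewrite /ip mulmxN mxE reFN. Qed.

Lemma ipZl n t (u v : 'cV[F]_n) : ip (ofR t *: u) v = t * ip u v.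
Proof. by rewrite /ip madjZ -scalemxAl mxE reF_ofRM. Qed.

Lemma ipZr n t (u v : 'cV[F]_n) : ip u (ofR t *: v) = t * ip u v.
Proof. by rewrite /ip -scalemxAr mxE reF_ofRM. Qed.

Lemma ip_sym n (u v : 'cV[F]_n) : ip u v = ip v u.
Proof.
rewrite /ip -[in LHS](madjK v) -madjM.
by rewrite !mxE reF_conj.
Qed.

Lemma ip_adj m n (a : 'M[F]_(m, n)) u v : ip u (a *m v) = ip (madj a *m u) v.
Proof. by rewrite /ip madjM madjK mulmxA. Qed.

Lemma ip0r n (u : 'cV[F]_n) : ip u 0 = 0.
Proof. by rewrite /ip mulmx0 mxE reF0. Qed.

Lemma ipvvE n (v : 'cV[F]_n) : ip v v = \sum_i abs2 (v i 0).
Proof. by rewrite /ip mxE reF_sum; apply: eq_bigr => i _; rewrite !mxE. Qed.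

Lemma ip_ge0 n (v : 'cV[F]_n) : 0 <= ip v v.
Proof. by rewrite ipvvE; apply: sumr_ge0 => i _; apply: abs2_ge0. Qed.

Lemma ip_eq0 n (v : 'cV[F]_n) : ip v v = 0 -> v = 0.
Proof.
rewrite ipvvE => /eqP; rewrite psumr_eq0 => [/allP h|i _]; last exact: abs2_ge0.
apply/matrixP => i j; rewrite ord1 mxE.
by apply: abs2_eq0; apply/eqP; apply: h; rewrite mem_index_enum.
Qed.

Lemma ip_gt0 n (v : 'cV[F]_n) : v != 0 -> 0 < ip v v.
Proof.
by move=> v0; rewrite lt_def ip_ge0 andbT; apply: contraNN v0 => /eqP/ip_eq0 ->.
Qed.

Lemma ip_col m n (u u' : 'cV[F]_m) (v v' : 'cV[F]_n) :
  ip (col_mx u v) (col_mx u' v') = ip u u' + ip v v'.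
Proof. by rewrite /ip madj_col mul_row_col mxE reFD. Qed.

Lemma ipZZ n a (v : 'cV[F]_n) : ip (a *: v) (a *: v) = abs2 a * ip v v.
Proof. by rewrite !ipvvE mulr_sumr; apply: eq_bigr => i _; rewrite mxE abs2M. Qed.

(** Expand [0 <= ‖s u - v‖^2] and divide by [s]. With a suitable weight [s] this does the work of
    Cauchy-Schwarz without square roots. *)
Lemma ip_young n s (u v : 'cV[F]_n) : 0 < s ->
  2 * ip u v <= s * ip u u + s^-1 * ip v v.
Proof.
move=> s0; have := ip_ge0 (ofR s *: u - v).
rewrite ipDl !ipDr !(ipNl, ipNr) !ipZl !ipZr (ip_sym v u) => h.
rewrite -subr_ge0; set X := _ - _.
suff -> : X = s^-1 * (s * (s * ip u u) - s * ip u v + (- (s * ip u v) - - ip v v)).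
  by rewrite mulr_ge0 // invr_ge0 ltW.
by rewrite /X; field; rewrite gt_eqF.
Qed.

Lemma ip_parallelogram n (u v : 'cV[F]_n) :
  ip (u + v) (u + v) + ip (u - v) (u - v) = 2 * (ip u u + ip v v).
Proof. rewrite !ipDl !ipDr !(ipNl, ipNr); lra. Qed.

(** * Operator norm and quadratic forms *)

Lemma vnormE n (v : 'cV[F]_n) : vnorm v = Num.sqrt (ip v v).
Proof. by rewrite ipvvE. Qed.

(** Induction on the number of columns: split off the first one and use
    [‖p + q‖^2 <= 2 (‖p‖^2 + ‖q‖^2)], from the parallelogram law. The crude constant only serves to
    make the supremum in [opnorm] finite. *)
Lemma mulmx_ip_bounded m n (a : 'M[F]_(m, n)) :
  exists2 M : R, 0 <= M & forall v, ip (a *m v) (a *m v) <= M * ip v v.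
Proof.
elim: n a => [|n IH] a.
  exists 0 => // v; rewrite mul0r.
  have -> : a *m v = 0 by apply/matrixP => i j; rewrite !mxE big_ord0.
  by rewrite ip0r.
rewrite -[n.+1]/(1 + n)%N in a *.
have [M M0 hM] := IH (rsubmx a).
set c := lsubmx a; have c0 := ip_ge0 c.
exists (2 * (ip c c + M)) => [|v]; first by rewrite mulr_ge0 ?addr_ge0.
rewrite -[a]hsubmxK -[v]vsubmxK mul_row_col ip_col -/c.
set u := usubmx v; set w := dsubmx v.
have -> : c *m u = u 0 0 *: c.
  by apply/matrixP => i j; rewrite [LHS]mxE big_ord1 [RHS]mxE !ord1 mulrC.
have /= h := hM w.
have := ip_parallelogram (u 0 0 *: c) (rsubmx a *m w).
have := ip_ge0 (u 0 0 *: c - rsubmx a *m w).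
rewrite ipZZ.
have -> : ip u u = abs2 (u 0 0) by rewrite ipvvE big_ord1.
have := abs2_ge0 (u 0 0); have := ip_ge0 w.
set x := abs2 _; set y := ip w w; set z := ip c c in c0 *.
set p := ip (rsubmx a *m w) (rsubmx a *m w) in h *.
move=> y0 x0 h1 h2; move: h h1 h2.
rewrite -/y; have := mulr_ge0 y0 c0; have := mulr_ge0 x0 M0; lra.
Qed.

Lemma opnorm_has_sup m n (a : 'M[F]_(m, n)) :
  has_sup [set vnorm (a *m v) | v in [set v : 'cV[F]_n | vnorm v <= 1]].
Proof.
split.
  by exists (vnorm (a *m 0)), 0 => //=; rewrite vnormE ip0r sqrtr0.
have [M M0 hM] := mulmx_ip_bounded a.
exists (Num.sqrt M) => _ [v /= hv <-].
rewrite !vnormE in hv *; apply: ler_wsqrtr.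
apply: le_trans (hM v) _; rewrite -[leRHS]mulr1 ler_wpM2l //.
by rewrite -ler_sqrt ?ip_ge0 // sqrtr1.
Qed.

Lemma opnorm_ge0 m n (a : 'M[F]_(m, n)) : 0 <= opnorm a.
Proof.
have [_ ub] := opnorm_has_sup a.
apply: (le_trans (sqrtr_ge0 _)); apply: (ub_le_sup ub).
by exists 0 => //=; rewrite vnormE ip0r sqrtr0.
Qed.

(** A nonzero [v] is rescaled to norm one, where the supremum applies. *)
Lemma opnorm_ub m n (a : 'M[F]_(m, n)) v :
  ip (a *m v) (a *m v) <= opnorm a ^+ 2 * ip v v.
Proof.
have [->|v0] := eqVneq v 0; first by rewrite mulmx0 !ip0r mulr0.
have p := ip_gt0 v0; set s := Num.sqrt (ip v v).
have s0 : 0 < s by rewrite sqrtr_gt0.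
have s2 : s ^+ 2 = ip v v by rewrite sqr_sqrtr ?ltW.
have [_ ub] := opnorm_has_sup a.
have : vnorm (a *m (ofR s^-1 *: v)) <= opnorm a.
  apply: (ub_le_sup ub); exists (ofR s^-1 *: v) => //=.
  by rewrite vnormE ipZZ abs2_ofR -s2 -exprMn mulVf ?gt_eqF // expr1n sqrtr1.
rewrite vnormE -scalemxAr ipZZ abs2_ofR sqrtrM ?sqr_ge0 // sqrtr_sqr.
have si : 0 <= s^-1 by rewrite invr_ge0 ltW.
rewrite (ger0_norm si) ler_pdivrMl // => h.
rewrite -s2 -exprMn -[leLHS]sqr_sqrtr ?ip_ge0 //.
have so : 0 <= s * opnorm a by rewrite mulr_ge0 ?opnorm_ge0 ?ltW.
by rewrite [opnorm a * _]mulrC lerXn2r ?nnegrE ?sqrtr_ge0 //.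
Qed.

Lemma opnorm_lub m n (a : 'M[F]_(m, n)) c : 0 <= c ->
  (forall v, ip (a *m v) (a *m v) <= c ^+ 2 * ip v v) -> opnorm a <= c.
Proof.
move=> c0 h; apply: ge_sup; first by case: (opnorm_has_sup a).
move=> _ [v /= hv <-]; rewrite !vnormE in hv *.
rewrite -[c]ger0_norm // -sqrtr_sqr; apply: ler_wsqrtr.
apply: le_trans (h v) _; rewrite -[leRHS]mulr1 ler_wpM2l ?sqr_ge0 //.
by rewrite -ler_sqrt ?ip_ge0 // sqrtr1.
Qed.

(** Write [‖a^* v‖^2] as the pairing of [v] with [a a^* v] and apply [ip_young] with weight [‖a‖^2];
    half of the resulting bound is absorbed on the left. *)
Lemma opnorm_madj m n (a : 'M[F]_(m, n)) : opnorm (madj a) <= opnorm a.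
Proof.
apply: opnorm_lub (opnorm_ge0 a) _ => v.
have hX : ip (madj a *m v) (madj a *m v) = ip v (a *m (madj a *m v)).
  by rewrite [RHS]ip_adj.
have := opnorm_ub a (madj a *m v).
have [->|c0] := eqVneq (opnorm a) 0.
  rewrite expr0n !mul0r => h; rewrite hX.
  suff -> : a *m (madj a *m v) = 0 by rewrite ip0r.
  by apply: ip_eq0; apply/le_anti; rewrite h ip_ge0.
have c2 : 0 < opnorm a ^+ 2 by rewrite exprn_gt0 // lt_def c0 opnorm_ge0.
have := ip_young v (a *m (madj a *m v)) c2; rewrite -hX.
set X := ip (madj a *m v) _; set c := _ ^+ 2 in c2 *; set Y := ip (a *m _) _ => h1 h2.
have : c^-1 * Y <= X by rewrite ler_pdivrMl.
lra.
Qed.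

(** In [ip_young] with weight [opnorm A], each term is at most [‖A‖ ‖v‖^2]. A zero norm is not an
    admissible weight and is treated apart. *)
Lemma quad_le_opnorm n (A : 'M[F]_n) v : ip v (A *m v) <= opnorm A * ip v v.
Proof.
have h := opnorm_ub A v.
have [e|c0] := eqVneq (opnorm A) 0.
  rewrite e expr0n !mul0r in h *.
  suff -> : A *m v = 0 by rewrite ip0r.
  by apply: ip_eq0; apply/le_anti; rewrite h ip_ge0.
have cp : 0 < opnorm A by rewrite lt_def c0 opnorm_ge0.
have := ip_young v (A *m v) cp.
have : (opnorm A)^-1 * ip (A *m v) (A *m v) <= opnorm A * ip v v.
  by rewrite ler_pdivrMl // mulrA -expr2.
lra.
Qed.

(** Polarization: with [w = s A v], the quadratic forms at [v + w] and [v - w] differ by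
    [4 s ‖A v‖^2], and the parallelogram law bounds this difference by [2 c (‖v‖^2 + ‖w‖^2)]. The
    best choice is [s = 1/c]. *)
Lemma opnorm_quad_le n (A : 'M[F]_n) c : 0 <= c -> madj A = A ->
  (forall v, `|ip v (A *m v)| <= c * ip v v) -> opnorm A <= c.
Proof.
move=> c0 sA h; apply: opnorm_lub => // v.
have key s : 4 * s * ip (A *m v) (A *m v) <=
    2 * c * (ip v v + s ^+ 2 * ip (A *m v) (A *m v)).
  set w := ofR s *: (A *m v).
  have e1 : s ^+ 2 * ip (A *m v) (A *m v) = ip w w by rewrite ipZZ abs2_ofR.
  have e2 : s * ip (A *m v) (A *m v) = ip w (A *m v) by rewrite ipZl.
  have e3 : ip v (A *m w) = ip w (A *m v) by rewrite ip_adj sA ip_sym.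
  have := h (v + w); have := h (v - w); rewrite !ler_norml => /andP[h1 _] /andP[_ h2].
  rewrite -mulrA e1 e2.
  have := ip_parallelogram v w.
  have e4 : ip (v + w) (A *m (v + w)) - ip (v - w) (A *m (v - w)) =
      4 * ip w (A *m v).
    by rewrite !mulmxDr mulmxN !ipDl !ipDr !(ipNl, ipNr) e3; lra.
  move: h1 h2 e4; set Q1 := ip (v + w) (A *m _); set Q2 := ip (v - w) (A *m _).
  set p := ip (v + w) _; set q := ip (v - w) _ => h1 h2 h4 h3.
  have : c * (p + q) = c * (2 * (ip v v + ip w w)) by rewrite h3.
  lra.
(* For [c = 0] the choice [s = 1] already forces [A v = 0]. *)
have [c0'|c0'] := eqVneq c 0.
  move: (key 1); rewrite c0' !(mulr0, mul0r, expr0n) /=; lra.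
have cp : 0 < c by rewrite lt_def c0'.
have := key c^-1; set X := ip _ _; move=> hX.
have : c * (4 * c^-1 * X) <= c * (2 * c * (ip v v + c^-1 ^+ 2 * X)) by rewrite ler_pM2l.
have -> : c * (4 * c^-1 * X) = 4 * X by field.
have -> : c * (2 * c * (ip v v + c^-1 ^+ 2 * X)) = 2 * c ^+ 2 * ip v v + 2 * X.
  by field.
lra.
Qed.

Lemma opnorm_eq0 m n (a : 'M[F]_(m, n)) : opnorm a = 0 -> a = 0.
Proof.
move=> a0; apply/matrixP => i j.
have : a *m delta_mx j (0 : 'I_1) = 0.
  apply: ip_eq0; apply/le_anti; rewrite ip_ge0 andbT.
  by apply: (le_trans (opnorm_ub _ _)); rewrite a0 expr0n mul0r.
by rewrite -colE => /matrixP/(_ i 0); rewrite !mxE.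
Qed.

Lemma opnorm_scalar n (a : F) : opnorm (a%:M : 'M[F]_n) <= absF a.
Proof.
apply: opnorm_lub => [|v]; first exact: sqrtr_ge0.
by rewrite mul_scalar_mx ipZZ sqr_sqrtr // abs2_ge0.
Qed.

End Scalars.

(** * Square roots of positive definite matrices *)

Definition posdef (R : realType) (F : scalars R) n (A : 'M[F]_n) : Prop :=
  madj A = A /\ forall v : 'cV[F]_n, v != 0 -> 0 < ip v (A *m v).

Section PositiveDefinite.
Variables (R : realType) (F : scalars R).
Hypothesis hF : is_RC F.

(** Selfadjointness of [A] makes [v^* A v] self-conjugate, so its sign in [F] is that of its real
    part. *)
Lemma psdP n (A : 'M[F]_n) :
  madj A = A -> (forall v, 0 <= ip v (A *m v)) -> psd A.
Proof.
move=> sA h; split=> // v; rewrite -mulmxA; apply: (geF0 hF) => //; last exact: h.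
have {2}-> : (madj v *m (A *m v)) = madj (madj v *m (A *m v)).
  by rewrite !(madjM hF) sA (madjK hF) mulmxA.
by rewrite [in RHS]mxE [in RHS]mxE.
Qed.

Lemma posdef_psd n (A : 'M[F]_n) : posdef A -> psd A.
Proof.
move=> [sA h]; apply: psdP => // v.
by have [->|/h/ltW//] := eqVneq v 0; rewrite mulmx0 (ip0r hF).
Qed.

Lemma posdef_unit n (A : 'M[F]_n) : posdef A -> A \in unitmx.
Proof.
move=> [sA h]; rewrite -unitmx_tr -row_free_unit -kermx_eq0.
apply/rowV0P => v /sub_kermxP hv.
apply/eqP; rewrite -[v]trmxK -trmx_eq0 trmxK; apply/negPn/negP => /h.
have -> : A *m v^T = 0 by rewrite -[A]trmxK -trmx_mul hv trmx0.
by rewrite (ip0r hF) ltxx.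
Qed.

(** Reduces the sign of a trace to quadratic forms of [A], one for each column of [E]. *)
Lemma mxtrace_adj_quad n (A E : 'M[F]_n) :
  sc_re (\tr (madj E *m A *m E)) = \sum_j ip (col j E) (A *m col j E).
Proof.
rewrite /mxtrace (reF_sum hF); apply: eq_bigr => j _; rewrite /ip -mulmxA; congr sc_re.
rewrite [LHS]mxE [RHS]mxE; apply: eq_bigr => i _.
by rewrite !mxE; congr (_ * _); apply: eq_bigr => k _; rewrite !mxE.
Qed.

(* With E = P - Q, the equation P E + E Q = 0 makes tr(E P E) + tr(E Q E) vanish. *)
Lemma posdef_sqrt_unique n (P Q : 'M[F]_n) :
  posdef P -> posdef Q -> P *m P = Q *m Q -> P = Q.
Proof.
move=> [sP hP] [sQ hQ] e; set E := P - Q.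
have sE : madj E = E by rewrite (madjD hF) (madjN hF) sP sQ.
have PE : P *m E + E *m Q = 0.
  by rewrite /E mulmxBr mulmxBl e addrA subrK subrr.
have h0 (B : 'M[F]_n) : (forall v, v != 0 -> 0 < ip v (B *m v)) ->
    forall v, 0 <= ip v (B *m v).
  by move=> hB v; have [->|/hB/ltW//] := eqVneq v 0; rewrite mulmx0 (ip0r hF).
have tr0 : \sum_j ip (col j E) (P *m col j E) +
           \sum_j ip (col j E) (Q *m col j E) = 0.
  rewrite -!mxtrace_adj_quad -(reFD hF) sE (mxtrace_mulC (E *m Q)) -mxtraceD.
  by rewrite -(mulmxA E P) -mulmxDr PE mulmx0 mxtrace0 (reF0 hF).
have h1 : \sum_j ip (col j E) (P *m col j E) = 0.
  apply/le_anti/andP; split; last by apply: sumr_ge0 => j _; apply: h0.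
  rewrite -[leRHS]tr0 lerDl; apply: sumr_ge0 => j _; exact: h0.
have E0 j : col j E = 0.
  move/eqP: h1; rewrite psumr_eq0 => [/allP h1|k _]; last exact: h0.
  apply/eqP/negPn/negP => /hP; rewrite lt_def.
  by have /eqP -> := h1 j (mem_index_enum j); rewrite eqxx.
apply/eqP; rewrite -subr_eq0 -/E; apply/eqP/matrixP => i j.
by have /matrixP/(_ i 0) := E0 j; rewrite !mxE.
Qed.

(** The eigenvalues are positive reals, and the root is [U^* sqrt(d) U]. *)
Lemma posdef_sqrt_of_diag n (A U : 'M[F]_n) (d : 'rV[F]_n) :
  posdef A -> U *m madj U = 1%:M -> A = madj U *m diag_mx d *m U ->
  exists2 c, posdef c & c *m c = A.
Proof.
move=> [sA hA] UU eA.
have UU' : madj U *m U = 1%:M by apply: mulmx1C.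
have eD : diag_mx d = U *m A *m madj U.
  by rewrite eA !mulmxA UU mul1mx -mulmxA UU mulmx1.
have sD : madj (diag_mx d) = diag_mx d.
  by rewrite eD !(madjM hF) sA (madjK hF) mulmxA.
have dR i : sc_conj (d 0 i) = d 0 i.
  by have /matrixP/(_ i i) := sD; rewrite !mxE eqxx !mulr1n.
(* The eigenvalue [d 0 i] is the value of the form of [A] at the nonzero vector [U^* e_i]. *)
have dP i : 0 < sc_re (d 0 i).
  have v0 : madj U *m delta_mx i (0 : 'I_1) != 0.
    apply/negP => /eqP /(congr1 (mulmx U)).
    rewrite mulmxA UU mul1mx mulmx0 => /matrixP/(_ i 0); rewrite !mxE !eqxx /=.
    by move/eqP; rewrite oner_eq0.
  have := hA _ v0; rewrite eA.
  rewrite -(ip_adj hF) !mulmxA UU mul1mx -(mulmxA (diag_mx d) U) UU mulmx1.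
  set ei := delta_mx i (0 : 'I_1); rewrite /ip.
  suff -> : (madj ei *m (diag_mx d *m ei)) 0 0 = d 0 i by [].
  rewrite -colE mxE (bigD1 i) //= big1 => [|j ne].
    by rewrite !mxE !eqxx (conjF1 hF) mul1r mulr1n addr0.
  by rewrite !mxE (negPf ne) (conjF0 hF) mul0r.
pose r i := Num.sqrt (sc_re (d 0 i)).
pose dg (f : 'I_n -> R) : 'M[F]_n := diag_mx (\row_i sc_ofR F (f i)).
have sdg f : madj (dg f) = dg f.
  apply/matrixP => i j; rewrite !mxE eq_sym; case: eqP => [->|_].
    by rewrite !mulr1n (conjF_ofR hF).
  by rewrite !mulr0n (conjF0 hF).
have mdg f g : dg f *m dg g = dg (fun i => f i * g i).
  by rewrite mulmx_diag; congr diag_mx; apply/rowP => i; rewrite !mxE (ofRM hF).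
have edg f g : f =1 g -> dg f = dg g.
  by move=> fg; congr diag_mx; apply/rowP => i; rewrite !mxE fg.
(* Fourth roots of the eigenvalues: the square root then has the form [M^* M], whose quadratic form
   is [‖M v‖^2]. *)
pose M := dg (fun i => Num.sqrt (r i)) *m U.
have eM : madj M *m M = madj U *m dg r *m U.
  rewrite (madjM hF) sdg !mulmxA -(mulmxA (madj U)) mdg; congr (_ *m _ *m _).
  by apply: edg => i; rewrite -expr2 sqr_sqrtr // sqrtr_ge0.
have cc : (madj M *m M) *m (madj M *m M) = A.
  rewrite eM !mulmxA -(mulmxA _ U) UU mulmx1 -(mulmxA (madj U)) mdg eA.
  congr (_ *m _ *m _); congr diag_mx; apply/rowP => i; rewrite !mxE.
  by rewrite -expr2 sqr_sqrtr ?ltW // (ofR_re hF).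
exists (madj M *m M) => //; split; first by rewrite (madjM hF) (madjK hF).
move=> v v0; rewrite -(mulmxA (madj M)) (ip_adj hF) (madjK hF); apply: (ip_gt0 hF).
(* If [M v = 0] then [A v = 0], contradicting definiteness of [A]. *)
apply/negP => /eqP Mv; have := hA _ v0.
rewrite -cc -(mulmxA _ _ v) -(mulmxA _ M v) Mv !mulmx0.
by rewrite (ip0r hF) ltxx.
Qed.

End PositiveDefinite.

(** A selfadjoint complex matrix is normal, so the spectral theorem diagonalizes it by a unitary. *)
Lemma complex_posdef_sqrt (R : realType) n (A : 'M[complexScalars R]_n) :
  posdef A -> exists2 c, posdef c & c *m c = A.
Proof.
move=> pA; have [sA _] := pA.
have nA : (A : 'M[R[i]]_n) \is normalmx.
  apply: hermitian_normalmx; apply/is_hermitianmxP; rewrite expr0 scale1r.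
  by rewrite -[LHS]sA /madj map_trmx.
have /orthomx_spectralP := nA.
rewrite invmx_unitary ?spectral_unitarymx //.
have /unitarymxP := spectral_unitarymx (A : 'M[R[i]]_n).
rewrite -map_trmx => UU eA.
apply: (posdef_sqrt_of_diag _ pA UU eA); by right.
Qed.

(** The entrywise embedding [toC] is injective and preserves products, adjoints and [ip], so a
    complex root with real entries descends. *)
Lemma real_posdef_sqrt (R : realType) n (A : 'M[realScalars R]_n) :
  posdef A -> exists2 c, posdef c & c *m c = A.
Proof.
move=> [sA hA]; have hR : is_RC (realScalars R) by left.
have hC : is_RC (complexScalars R) by right.
pose toC m p (B : 'M[realScalars R]_(m, p)) : 'M[complexScalars R]_(m, p) :=
  map_mx (fun x : R => (x%:C)%C) B.
have toCM m p q (B : 'M[realScalars R]_(m, p)) (B' : 'M_(p, q)) :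
    toC _ _ (B *m B') = toC _ _ B *m toC _ _ B'.
  exact: (map_mxM (real_complex R)).
have toC_adj m p (B : 'M[realScalars R]_(m, p)) : madj (toC _ _ B) = toC _ _ (madj B).
  by apply/matrixP => i j; rewrite !mxE /= complex_conjE conjc_real.
have toC_inj m p : injective (toC m p).
  by move=> B B' /matrixP h; apply/matrixP => i j; have := h i j; rewrite !mxE => -[].
have toC_ip m (u v : 'cV[realScalars R]_m) : ip (toC _ _ u) (toC _ _ v) = ip u v.
  by rewrite /ip toC_adj -toCM mxE.
pose iC : complexScalars R := ('i%C : R[i]).
have ip_i m (u v : 'cV[complexScalars R]_m) :
    ip (iC *: u) (iC *: v) = ip u v.
  rewrite /ip !mxE; congr sc_re; apply: eq_bigr => k _; rewrite !mxE /=.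
  rewrite !complex_conjE rmorphM mulrACA.
  suff -> : ('i%C : R[i])^*%C * 'i%C = 1 by rewrite mul1r.
  by apply/eqP; rewrite eq_complex /=; apply/andP; split; apply/eqP; lra.
pose conjm m p (B : 'M[complexScalars R]_(m, p)) : 'M[complexScalars R]_(m, p) :=
  map_mx (@conjc R) B.
have conjmM m p q (B : 'M[complexScalars R]_(m, p)) (B' : 'M_(p, q)) :
    conjm _ _ (B *m B') = conjm _ _ B *m conjm _ _ B'.
  exact: (map_mxM (@conjc R)).
have conjmK m p : involutive (conjm m p).
  by move=> B; apply/matrixP => i j; rewrite !mxE conjcK.
have conjm_adj m p (B : 'M[complexScalars R]_(m, p)) :
    madj (conjm _ _ B) = conjm _ _ (madj B).
  by apply/matrixP => i j; rewrite !mxE.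
have conjm_ip m (u v : 'cV[complexScalars R]_m) :
    ip (conjm _ _ u) (conjm _ _ v) = ip u v.
  by rewrite /ip conjm_adj -conjmM mxE -complex_conjE (reF_conj hC).
have pC : posdef (toC _ _ A).
  split=> [|v v0]; first by rewrite toC_adj sA.
  pose a : 'cV[realScalars R]_n := map_mx (@complex.Re R) v.
  pose b : 'cV[realScalars R]_n := map_mx (@complex.Im R) v.
  have ev : v = toC _ _ a + iC *: toC _ _ b.
    by apply/matrixP => k l; rewrite !mxE [LHS]complexE.
  rewrite ev mulmxDr -scalemxAr -!toCM (ipDl hC) !(ipDr hC) ip_i !toC_ip.
  (* For [v = a + i b] the cross terms are purely imaginary, hence invisible to [ip]; the forms of
     [A] at [a] and at [b] remain. *)
  have e0 (u w : 'cV[realScalars R]_n) :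
      ip (toC _ _ u) (iC *: toC _ _ w) = 0.
    rewrite /ip -scalemxAr toC_adj -toCM !mxE /=.
    by rewrite mul0r mulr0 subr0.
  rewrite e0 (ip_sym hC _ (toC _ _ (A *m a))) e0 addr0 add0r.
  have ge u : 0 <= ip u (A *m u).
    by have [->|/hA/ltW//] := eqVneq u 0; rewrite mulmx0 (ip0r hR).
  have [a0|a0] := eqVneq a 0; last by rewrite ltr_wpDr // hA.
  have [b0|b0] := eqVneq b 0; last by rewrite ltr_wpDl // hA.
  move: v0; rewrite ev a0 b0.
  have -> : toC n 1%N 0 = 0 by apply/matrixP => i j; rewrite !mxE.
  by rewrite scaler0 addr0 eqxx.
have [c pc cc] := complex_posdef_sqrt pC; have [sc hc] := pc.
have pcc : posdef (conjm _ _ c).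
  split; first by rewrite conjm_adj sc.
  move=> v v0; rewrite -conjm_ip conjmM conjmK; apply: hc.
  apply: contra_neq v0 => e; rewrite -[v]conjmK e.
  by apply/matrixP => i j; rewrite !mxE conjc0.
(* Both are positive definite square roots of the same matrix, whose entries are real. *)
have cE : c = conjm _ _ c.
  apply: (posdef_sqrt_unique hC pc pcc); rewrite -conjmM cc.
  by apply/matrixP => i j; rewrite !mxE conjc_real.
pose r : 'M[realScalars R]_n := map_mx (@complex.Re R) c.
have cr : c = toC _ _ r.
  apply/matrixP => i j; have /matrixP/(_ i j) := cE; rewrite !mxE.
  by case: (c i j) => x y [] h; congr (_ +i* _)%C; lra.
exists r; last by apply: toC_inj; rewrite toCM -cr.
split; first by apply: toC_inj; rewrite -toC_adj -cr.
move=> v v0; rewrite -toC_ip toCM -cr; apply: hc.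
apply: contra_neq v0 => e; apply: toC_inj; rewrite e.
by apply/matrixP => i j; rewrite !mxE.
Qed.

Lemma posdef_sqrt (R : realType) (F : scalars R) n (A : 'M[F]_n) :
  is_RC F -> posdef A -> exists2 c, posdef c & c *m c = A.
Proof.
move=> hF; case: hF A => -> A; [exact: real_posdef_sqrt|exact: complex_posdef_sqrt].
Qed.

(** * Matrices over a module *)

Section ModuleMatrices.
Variables (R : realType) (F : scalars R) (E : lmodType F).

Lemma mxEmulA k l m n p q (a : 'M[F]_(k, l)) (b : 'M[F]_(l, m)) (x : 'M[E]_(m, n))
    (c : 'M[F]_(n, p)) (d : 'M[F]_(p, q)) :
  mxEmul a (mxEmul b x c) d = mxEmul (a *m b) x (c *m d).
Proof.
apply/matrixP => r s; rewrite !mxE.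
under eq_bigr => i _ do under eq_bigr => j _ do rewrite mxE scaler_sumr.
under eq_bigr => i _ do under eq_bigr => j _ do
  under eq_bigr => i' _ do rewrite scaler_sumr.
under eq_bigr => i _ do rewrite exchange_big.
rewrite exchange_big; apply: eq_bigr => i' _.
under eq_bigr => i _ do rewrite exchange_big.
rewrite exchange_big; apply: eq_bigr => j' _.
rewrite !mxE mulr_suml scaler_suml; apply: eq_bigr => i _.
rewrite mulr_sumr scaler_suml; apply: eq_bigr => j _.
by rewrite scalerA mulrACA [d j s * _]mulrC.
Qed.

Lemma mxEmulD k m n p (a : 'M[F]_(k, m)) (x y : 'M[E]_(m, n)) (b : 'M[F]_(n, p)) :
  mxEmul a (x + y) b = mxEmul a x b + mxEmul a y b.
Proof.
apply/matrixP => r s; rewrite !mxE -big_split; apply: eq_bigr => i _.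
by rewrite -big_split; apply: eq_bigr => j _; rewrite mxE scalerDr.
Qed.

Lemma mxEmulN k m n p (a : 'M[F]_(k, m)) (x : 'M[E]_(m, n)) (b : 'M[F]_(n, p)) :
  mxEmul a (- x) b = - mxEmul a x b.
Proof.
apply/matrixP => r s; rewrite !mxE -sumrN; apply: eq_bigr => i _.
by rewrite -sumrN; apply: eq_bigr => j _; rewrite mxE scalerN.
Qed.

Lemma mxEmulx0 k m n p (a : 'M[F]_(k, m)) (b : 'M[F]_(n, p)) :
  mxEmul a (0 : 'M[E]_(m, n)) b = 0.
Proof.
apply/matrixP => r s; rewrite !mxE big1 // => i _; rewrite big1 // => j _.
by rewrite mxE scaler0.
Qed.

Lemma mxEmul0l k m n p (x : 'M[E]_(m, n)) (b : 'M[F]_(n, p)) :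
  mxEmul (0 : 'M[F]_(k, m)) x b = 0.
Proof.
apply/matrixP => r s; rewrite !mxE big1 // => i _; rewrite big1 // => j _.
by rewrite mxE mul0r scale0r.
Qed.

Lemma mxEmul0r k m n p (a : 'M[F]_(k, m)) (x : 'M[E]_(m, n)) :
  mxEmul a x (0 : 'M[F]_(n, p)) = 0.
Proof.
apply/matrixP => r s; rewrite !mxE big1 // => i _; rewrite big1 // => j _.
by rewrite mxE mulr0 scale0r.
Qed.

Lemma mxEmulNl k m n p (a : 'M[F]_(k, m)) (x : 'M[E]_(m, n)) (b : 'M[F]_(n, p)) :
  mxEmul (- a) x b = - mxEmul a x b.
Proof.
apply/matrixP => r s; rewrite !mxE -sumrN; apply: eq_bigr => i _.
by rewrite -sumrN; apply: eq_bigr => j _; rewrite mxE mulNr scaleNr.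
Qed.

Lemma mxEmulNr k m n p (a : 'M[F]_(k, m)) (x : 'M[E]_(m, n)) (b : 'M[F]_(n, p)) :
  mxEmul a x (- b) = - mxEmul a x b.
Proof.
apply/matrixP => r s; rewrite !mxE -sumrN; apply: eq_bigr => i _.
by rewrite -sumrN; apply: eq_bigr => j _; rewrite mxE mulrN scaleNr.
Qed.

Lemma mxEmul_scalar m n (a b : F) (x : 'M[E]_(m, n)) :
  mxEmul a%:M x b%:M = mscale (a * b) x.
Proof.
apply/matrixP => r s; rewrite !mxE (bigD1 r) //= [X in _ + X]big1 ?addr0.
  rewrite (bigD1 s) //= [X in _ + X]big1 ?addr0 => [|j ne].
    by rewrite !mxE !eqxx !mulr1n.
  by rewrite !mxE (negPf ne) mulr0n mulr0 scale0r.
move=> i ne; rewrite big1 // => j _.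
by rewrite !mxE eq_sym (negPf ne) mulr0n mul0r scale0r.
Qed.

Lemma mscale1 m n (x : 'M[E]_(m, n)) : mscale 1 x = x.
Proof. by apply/matrixP => i j; rewrite mxE scale1r. Qed.

Lemma mxEmul1 m n (x : 'M[E]_(m, n)) : mxEmul 1%:M x 1%:M = x.
Proof. by rewrite mxEmul_scalar mulr1 mscale1. Qed.

Lemma mxEmul_col_row k1 k2 m n p1 p2 (a1 : 'M[F]_(k1, m)) (a2 : 'M[F]_(k2, m))
    (x : 'M[E]_(m, n)) (b1 : 'M[F]_(n, p1)) (b2 : 'M[F]_(n, p2)) :
  mxEmul (col_mx a1 a2) x (row_mx b1 b2) =
  block_mx (mxEmul a1 x b1) (mxEmul a1 x b2) (mxEmul a2 x b1) (mxEmul a2 x b2).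
Proof.
apply/matrixP => r s; rewrite mxE.
case: (split_ordP r) => r' ->; case: (split_ordP s) => s' ->;
  rewrite ?(block_mxEul, block_mxEur, block_mxEdl, block_mxEdr) mxE;
  apply: eq_bigr => i _; apply: eq_bigr => j _;
  by rewrite ?(col_mxEu, col_mxEd, row_mxEl, row_mxEr).
Qed.

Lemma mxEmul_row_col k m1 m2 n1 n2 p (a1 : 'M[F]_(k, m1)) (a2 : 'M[F]_(k, m2))
    (x11 : 'M[E]_(m1, n1)) x12 x21 (x22 : 'M[E]_(m2, n2))
    (b1 : 'M[F]_(n1, p)) (b2 : 'M[F]_(n2, p)) :
  mxEmul (row_mx a1 a2) (block_mx x11 x12 x21 x22) (col_mx b1 b2) =
  (mxEmul a1 x11 b1 + mxEmul a1 x12 b2) + (mxEmul a2 x21 b1 + mxEmul a2 x22 b2).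
Proof.
apply/matrixP => r s; rewrite !mxE big_split_ord /= -!big_split /=.
congr (_ + _); apply: eq_bigr => i _; rewrite big_split_ord /=.
  congr (_ + _); apply: eq_bigr => j _;
  by rewrite ?(block_mxEul, block_mxEur) ?(col_mxEu, col_mxEd) row_mxEl.
congr (_ + _); apply: eq_bigr => j _;
by rewrite ?(block_mxEdl, block_mxEdr) ?(col_mxEu, col_mxEd) row_mxEr.
Qed.

Lemma mxEmul_diag_block k1 k2 m1 m2 n1 n2 p1 p2
    (a : 'M[F]_(k1, m1)) (b : 'M[F]_(k2, m2))
    (x11 : 'M[E]_(m1, n1)) x12 x21 (x22 : 'M[E]_(m2, n2))
    (c : 'M[F]_(n1, p1)) (d : 'M[F]_(n2, p2)) :
  mxEmul (block_mx a 0 0 b) (block_mx x11 x12 x21 x22) (block_mx c 0 0 d) =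
  block_mx (mxEmul a x11 c) (mxEmul a x12 d) (mxEmul b x21 c) (mxEmul b x22 d).
Proof.
rewrite (block_mxEv a) (block_mxEh c) mxEmul_col_row !mxEmul_row_col.
by rewrite !mxEmul0l !mxEmul0r !(addr0, add0r).
Qed.

(** Conjugation by the flip exchanges the hermitian blocks of [x] and of its adjoint. *)
Lemma mxEmul_swap n (x11 x12 x21 x22 : 'M[E]_n) :
  mxEmul (block_mx 0 1%:M 1%:M 0) (block_mx x11 x12 x21 x22)
    (block_mx 0 1%:M 1%:M 0) = block_mx x22 x21 x12 x11.
Proof.
rewrite {1}(block_mxEv 0) (block_mxEh 0) mxEmul_col_row !mxEmul_row_col.
by rewrite !mxEmul0l !mxEmul0r !(addr0, add0r) !mxEmul1.
Qed.

Lemma ampl_mxEmul k m n p (f : E -> F) (a : 'M[F]_(k, m)) (x : 'M[E]_(m, n))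
    (b : 'M[F]_(n, p)) :
  (forall (c : F) (e e' : E), f (c *: e + e') = c * f e + f e') ->
  ampl f (mxEmul a x b) = a *m ampl f x *m b.
Proof.
move=> fl.
have f0 : f 0 = 0.
  have := fl 1 0 0; rewrite scaler0 addr0 mul1r => h.
  by apply: (addrI (f 0)); rewrite addr0 -h.
have fD u v : f (u + v) = f u + f v by rewrite -[u]scale1r fl mul1r scale1r.
have fZ c u : f (c *: u) = c * f u by rewrite -[c *: u]addr0 fl f0 addr0.
apply/matrixP => r s; rewrite !mxE (big_morph f fD f0).
under [RHS]eq_bigr => j _ do rewrite mxE mulr_suml.
rewrite [RHS]exchange_big; apply: eq_bigr => i _.
rewrite (big_morph f fD f0); apply: eq_bigr => j _.
by rewrite mxE fZ mulrAC.
Qed.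

Lemma mstar_mxEmul k m n p (star : E -> E) (a : 'M[F]_(k, m)) (x : 'M[E]_(m, n))
    (b : 'M[F]_(n, p)) :
  is_RC F ->
  (forall (c : F) (e e' : E), star (c *: e + e') = sc_conj c *: star e + star e') ->
  mstar star (mxEmul a x b) = mxEmul (madj b) (mstar star x) (madj a).
Proof.
move=> hF sl.
have s0 : star 0 = 0.
  have := sl 1 0 0; rewrite scaler0 addr0 (conjF1 hF) scale1r => h.
  by apply: (addrI (star 0)); rewrite addr0 -h.
have sD u v : star (u + v) = star u + star v.
  by rewrite -[u]scale1r sl (conjF1 hF) !scale1r.
have sZ c u : star (c *: u) = sc_conj c *: star u.
  by rewrite -[c *: u]addr0 sl s0 addr0.
apply/matrixP => r s; rewrite !mxE (big_morph star sD s0).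
under eq_bigr => i _ do rewrite (big_morph star sD s0).
rewrite exchange_big; apply: eq_bigr => j _; apply: eq_bigr => i _.
by rewrite sZ !mxE (conjFM hF) mulrC.
Qed.

End ModuleMatrices.

(** * The base norm *)

Section BaseNorm.
Variables (R : realType) (F : scalars R) (E : lmodType F).
Variables (star : E -> E) (C : forall n, set 'M[E]_n) (f1 : E -> F).
Arguments C {n}.
Hypothesis hF : is_RC F.
Hypothesis starK : forall e : E, star (star e) = e.
Hypothesis star_lin : forall (a : F) (e e' : E),
  star (a *: e + e') = sc_conj a *: star e + star e'.
Hypothesis C0 : forall n, (0 < n)%N -> C (0 : 'M[E]_n).
Hypothesis CD : forall n (x y : 'M[E]_n), (0 < n)%N -> C x -> C y -> C (x + y).
Hypothesis C_sa : forall n (x : 'M[E]_n), (0 < n)%N -> C x -> selfadj star x.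
Hypothesis C_conj : forall n m (a : 'M[F]_(n, m)) (x : 'M[E]_n),
  (0 < n)%N -> (0 < m)%N -> C x -> C (mxEmul (madj a) x a).
Hypothesis f1_lin : forall (a : F) (e e' : E), f1 (a *: e + e') = a * f1 e + f1 e'.
Hypothesis f1_star : forall e : E, f1 (star e) = sc_conj (f1 e).
Hypothesis f1_pos : forall x : 'M[E]_1, C x -> x <> 0 -> 0 < f1 (x 0 0).
Hypothesis C_gen : forall n (x : 'M[E]_n), (0 < n)%N -> selfadj star x ->
  exists2 y, C y & C (y - x).

Local Notation sanorm := (sanorm (@C) f1).
Local Notation mnorm := (mnorm star (@C) f1).
Local Notation fm := (ampl f1).

Lemma f1D e e' : f1 (e + e') = f1 e + f1 e'.
Proof. by rewrite -[e]scale1r f1_lin mul1r scale1r. Qed.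

Lemma f10 : f1 0 = 0.
Proof. by apply: (addrI (f1 0)); rewrite -f1D !addr0. Qed.

Lemma f1N e : f1 (- e) = - f1 e.
Proof. by apply: (addrI (f1 e)); rewrite -f1D !subrr f10. Qed.

Lemma starD e e' : star (e + e') = star e + star e'.
Proof. by rewrite -[e]scale1r star_lin (conjF1 hF) !scale1r. Qed.

Lemma star0 : star 0 = 0.
Proof. by apply: (addrI (star 0)); rewrite -starD !addr0. Qed.

Lemma starN e : star (- e) = - star e.
Proof. by apply: (addrI (star e)); rewrite -starD !subrr star0. Qed.

Lemma amplD m n (x y : 'M[E]_(m, n)) : fm (x + y) = fm x + fm y.
Proof. by apply/matrixP => i j; rewrite !mxE f1D. Qed.

Lemma amplN m n (x : 'M[E]_(m, n)) : fm (- x) = - fm x.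
Proof. by apply/matrixP => i j; rewrite !mxE f1N. Qed.

Lemma ampl_mstar m n (x : 'M[E]_(m, n)) : fm (mstar star x) = madj (fm x).
Proof. by apply/matrixP => i j; rewrite !mxE f1_star. Qed.

Lemma mstarD m n (x y : 'M[E]_(m, n)) :
  mstar star (x + y) = mstar star x + mstar star y.
Proof. by apply/matrixP => i j; rewrite !mxE starD. Qed.

Lemma mstarN m n (x : 'M[E]_(m, n)) : mstar star (- x) = - mstar star x.
Proof. by apply/matrixP => i j; rewrite !mxE starN. Qed.

Lemma mstarK m n (x : 'M[E]_(m, n)) : mstar star (mstar star x) = x.
Proof. by apply/matrixP => i j; rewrite !mxE starK. Qed.

Lemma madj_ampl n (x : 'M[E]_n) : selfadj star x -> madj (fm x) = fm x.
Proof. by move=> sx; rewrite -ampl_mstar sx. Qed.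

(** Compression becomes the substitution [v -> a v] in the form, so estimates for compressions
    reduce to bounds on [‖a v‖]. *)
Lemma ampl_conj_quad n m (a : 'M[F]_(n, m)) (x : 'M[E]_n) v :
  ip v (fm (mxEmul (madj a) x a) *m v) = ip (a *m v) (fm x *m (a *m v)).
Proof.
by rewrite (ampl_mxEmul _ _ _ f1_lin) -!mulmxA (ip_adj hF) (madjK hF).
Qed.

(** Complete positivity of [f1]: compressing [x] by the column [v] lands in the cone at level one,
    where [f1] is positive. *)
Lemma ampl_quad_ge0 n (x : 'M[E]_n) v : (0 < n)%N -> C x -> 0 <= ip v (fm x *m v).
Proof.
move=> n0 Cx; have /f1_pos h : C (mxEmul (madj v) x v) by exact: C_conj.
have -> : ip v (fm x *m v) = sc_re (f1 (mxEmul (madj v) x v 0 0)).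
  rewrite /ip mulmxA -(ampl_mxEmul _ _ _ f1_lin).
  by rewrite [ampl _ _ _ _]mxE.
have [->|/eqP/h/(reF_gt0 hF)/ltW //] := eqVneq (mxEmul (madj v) x v) 0.
by rewrite mxE f10 (reF0 hF).
Qed.

(** * The infimum defining the norm of a selfadjoint element *)

Lemma sanorm_has_lbound n (x : 'M[E]_n) : has_lbound
  [set opnorm (fm (yz.1 + yz.2)) | yz in
    [set yz : 'M[E]_n * 'M[E]_n | [/\ x = yz.1 - yz.2, C yz.1 & C yz.2]]].
Proof. by exists 0 => _ [yz _ <-]; apply: (opnorm_ge0 hF). Qed.

(** If [y] in the cone dominates [x], then [x = y - (y - x)] is a decomposition; over an empty set
    [inf] would be a default value. *)
Lemma sanorm_nonempty n (x : 'M[E]_n) : (0 < n)%N -> selfadj star x ->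
  nonempty [set opnorm (fm (yz.1 + yz.2)) | yz in
    [set yz : 'M[E]_n * 'M[E]_n | [/\ x = yz.1 - yz.2, C yz.1 & C yz.2]]].
Proof.
move=> n0 sx; have [y Cy Cyx] := C_gen n0 sx.
exists (opnorm (fm (y + (y - x)))), (y, y - x) => //=; split=> //.
by rewrite opprB addrC subrK.
Qed.

Lemma sanorm_ge0 n (x : 'M[E]_n) : (0 < n)%N -> selfadj star x -> 0 <= sanorm x.
Proof.
move=> n0 sx; apply: lb_le_inf; first exact: sanorm_nonempty.
by move=> _ [yz _ <-]; apply: (opnorm_ge0 hF).
Qed.

(** The matrix of [y + z] is positive semidefinite, so an upper bound on its form bounds its
    operator norm. *)
Lemma sanorm_ub n (y z : 'M[E]_n) c : (0 < n)%N -> C y -> C z -> 0 <= c ->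
  (forall v, ip v (fm (y + z) *m v) <= c * ip v v) -> sanorm (y - z) <= c.
Proof.
move=> n0 Cy Cz c0 h; apply: (@le_trans _ _ (opnorm (fm (y + z)))).
  by apply: ge_inf; [exact: sanorm_has_lbound|exists (y, z)].
have Cyz : C (y + z) by exact: CD.
apply: (opnorm_quad_le hF) => // [|v]; first by apply: madj_ampl; exact: C_sa.
by rewrite ger0_norm ?ampl_quad_ge0.
Qed.

Lemma sanorm_lt n (x : 'M[E]_n) c : (0 < n)%N -> selfadj star x -> sanorm x < c ->
  exists y z, [/\ C y, C z, x = y - z, opnorm (fm (y + z)) < c
    & forall v, ip v (fm (y + z) *m v) <= c * ip v v].
Proof.
move=> n0 sx h.
have [_ [[y z] [/= e Cy Cz] <-] lt] := inf_lt (sanorm_nonempty n0 sx) h.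
exists y, z; split=> // v; apply: (le_trans (quad_le_opnorm hF _ _)).
by rewrite ler_wpM2r ?(ip_ge0 hF) // ltW.
Qed.

(** Compress near-optimal decompositions of [x] and [y] by [a] and [b], and add: the forms at [a v]
    and [b v] share one constant, so only [‖a v‖^2 + ‖b v‖^2] matters. *)
Lemma sanorm_conj2 p q r (a : 'M[F]_(p, r)) (b : 'M[F]_(q, r)) x y k t :
  (0 < p)%N -> (0 < q)%N -> (0 < r)%N -> selfadj star x -> selfadj star y -> 0 <= k ->
  (forall v, ip (a *m v) (a *m v) + ip (b *m v) (b *m v) <= k * ip v v) ->
  sanorm x <= t -> sanorm y <= t ->
  sanorm (mxEmul (madj a) x a + mxEmul (madj b) y b) <= k * t.
Proof.
move=> p0 q0 r0 sx sy k0 hk hx hy; apply/ler_addgt0Pr => e e0.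
have k1 : 0 < k + 1 by lra.
(* With slack [e / (k + 1)] the final loss [k e / (k + 1)] is at most [e], also for [k = 0]. *)
have d0 : 0 < e / (k + 1) by rewrite divr_gt0.
set c := t + e / (k + 1).
have t0 : 0 <= t by exact: le_trans (sanorm_ge0 p0 sx) hx.
have c0 : 0 <= c by rewrite addr_ge0 // ltW.
have [|y1 [z1 [Cy1 Cz1 ex _ q1]]] := @sanorm_lt _ x c p0 sx.
  by rewrite /c; lra.
have [|y2 [z2 [Cy2 Cz2 ey _ q2]]] := @sanorm_lt _ y c q0 sy.
  by rewrite /c; lra.
apply: (@le_trans _ _ (k * c)); last first.
  rewrite /c mulrDr lerD2l mulrA ler_pdivrMr //; nra.
have -> : mxEmul (madj a) x a + mxEmul (madj b) y b =
    (mxEmul (madj a) y1 a + mxEmul (madj b) y2 b) -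
    (mxEmul (madj a) z1 a + mxEmul (madj b) z2 b).
  by rewrite ex ey !mxEmulD !mxEmulN opprD addrACA.
apply: sanorm_ub => //; try by apply: CD => //; exact: C_conj.
  exact: mulr_ge0.
move=> v.
have -> : mxEmul (madj a) y1 a + mxEmul (madj b) y2 b +
    (mxEmul (madj a) z1 a + mxEmul (madj b) z2 b) =
    mxEmul (madj a) (y1 + z1) a + mxEmul (madj b) (y2 + z2) b.
  by rewrite !mxEmulD addrACA.
rewrite amplD mulmxDl (ipDr hF) !ampl_conj_quad.
apply: (le_trans (lerD (q1 _) (q2 _))); rewrite -mulrDr -mulrA mulrCA.
exact: ler_wpM2l.
Qed.

Lemma sanorm_conj p r (a : 'M[F]_(p, r)) x k :
  (0 < p)%N -> (0 < r)%N -> selfadj star x -> 0 <= k ->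
  (forall v, ip (a *m v) (a *m v) <= k * ip v v) ->
  sanorm (mxEmul (madj a) x a) <= k * sanorm x.
Proof.
move=> p0 r0 sx k0 hk.
have := @sanorm_conj2 p p r a 0 x x k (sanorm x) p0 p0 r0 sx sx k0.
rewrite mxEmul0r addr0; apply=> // v.
by rewrite mul0mx (ip0r hF) addr0.
Qed.

Lemma sanormN n (x : 'M[E]_n) : sanorm (- x) = sanorm x.
Proof.
rewrite /Defs.sanorm; congr inf; apply/seteqP; split=> _ [[y z] [/= e Cy Cz] <-];
  (exists (z, y) => /=; last by rewrite addrC); split=> //.
  by rewrite -[x]opprK e opprB.
by rewrite e opprB.
Qed.

(** Produces the premise of (c): [y] and [z] are both dominated by [y + z], so their matrices have
    norm at most that of [y + z]. *)
Lemma sanorm_eq0 n (x : 'M[E]_n) : (0 < n)%N -> selfadj star x -> sanorm x = 0 ->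
  forall eps : R, 0 < eps -> exists y z,
    [/\ C y, C z, x = y - z, opnorm (fm y) < eps & opnorm (fm z) < eps].
Proof.
move=> n0 sx h eps e0.
have [|y [z [Cy Cz ex lt q]]] := @sanorm_lt _ x eps n0 sx; first by rewrite h.
have aux w w' : C w -> C w' -> w + w' = y + z -> opnorm (fm w) < eps.
  move=> Cw Cw' e; apply: le_lt_trans lt.
  apply: (opnorm_quad_le hF); first exact: (opnorm_ge0 hF).
    by apply: madj_ampl; exact: C_sa.
  move=> v; rewrite ger0_norm ?ampl_quad_ge0 // -e.
  apply: le_trans (quad_le_opnorm hF _ _).
  by rewrite amplD mulmxDl (ipDr hF) lerDl ampl_quad_ge0.
exists y, z; split=> //; [exact: aux Cy Cz _|apply: aux Cz Cy _].
by rewrite addrC.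
Qed.

(** Near-optimal decompositions are added directly, because [sanorm_conj2] would only give twice the
    maximum. *)
Lemma sanormD n (x y : 'M[E]_n) : (0 < n)%N -> selfadj star x -> selfadj star y ->
  sanorm (x + y) <= sanorm x + sanorm y.
Proof.
move=> n0 sx sy; apply/ler_addgt0Pr => e e0.
have [|y1 [z1 [Cy1 Cz1 ex _ q1]]] := @sanorm_lt _ x (sanorm x + e / 2) n0 sx.
  by lra.
have [|y2 [z2 [Cy2 Cz2 ey _ q2]]] := @sanorm_lt _ y (sanorm y + e / 2) n0 sy.
  by lra.
have -> : x + y = (y1 + y2) - (z1 + z2) by rewrite ex ey opprD addrACA.
have := sanorm_ge0 n0 sx; have := sanorm_ge0 n0 sy => s1 s2.
apply: sanorm_ub; rewrite ?addr_ge0 ?(ltW e0) //; try exact: CD.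
move=> v; rewrite addrACA amplD mulmxDl (ipDr hF).
apply: (le_trans (lerD (q1 _) (q2 _))); rewrite -mulrDl.
by have -> : sanorm x + e / 2 + (sanorm y + e / 2) = sanorm x + sanorm y + e by lra.
Qed.

(** If [x = y - z], then [-(y + z) <= x <= y + z], so the form of [x] is bounded in absolute value
    by that of [y + z]. *)
Lemma opnorm_ampl_le_sanorm n (x : 'M[E]_n) : (0 < n)%N -> selfadj star x ->
  opnorm (fm x) <= sanorm x.
Proof.
move=> n0 sx; apply/ler_addgt0Pr => e e0.
have [|y [z [Cy Cz ex _ q]]] := @sanorm_lt _ x (sanorm x + e) n0 sx.
  by lra.
have s0 := sanorm_ge0 n0 sx.
apply: (opnorm_quad_le hF); [by lra|exact: madj_ampl|move=> v].
apply: le_trans (q v); rewrite ex !amplD amplN !mulmxDl mulNmx !(ipDr hF) (ipNr hF).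
have := ampl_quad_ge0 v n0 Cy; have := ampl_quad_ge0 v n0 Cz.
by rewrite ler_norml => h1 h2; apply/andP; split; lra.
Qed.

(** * General elements, through their hermitian blocks *)

Definition hermblock n (x : 'M[E]_n) : 'M[E]_(n + n) := block_mx 0 x (mstar star x) 0.

Lemma mstar0 m n : mstar star (0 : 'M[E]_(m, n)) = 0.
Proof. by apply/matrixP => i j; rewrite !mxE star0. Qed.

Lemma mstar_block m1 m2 n1 n2 (a : 'M[E]_(m1, n1)) b c (d : 'M[E]_(m2, n2)) :
  mstar star (block_mx a b c d) =
  block_mx (mstar star a) (mstar star c) (mstar star b) (mstar star d).
Proof.
have e m n (x : 'M[E]_(m, n)) : mstar star x = (map_mx star x)^T.
  by apply/matrixP => i j; rewrite !mxE.
by rewrite !e map_block_mx tr_block_mx.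
Qed.

Lemma selfadj_hermblock n (x : 'M[E]_n) : selfadj star (hermblock x).
Proof. by rewrite /selfadj mstar_block !mstar0 mstarK. Qed.

Lemma hermblockD n (x y : 'M[E]_n) : hermblock (x + y) = hermblock x + hermblock y.
Proof. by rewrite /hermblock mstarD add_block_mx !addr0. Qed.

(** A two-sided product becomes a compression by a block diagonal matrix, to which the selfadjoint
    estimates apply. *)
Lemma hermblock_mxEmul n m (a : 'M[F]_(m, n)) (x : 'M[E]_n) (b : 'M[F]_(n, m)) :
  let d := block_mx (madj a) 0 0 b in
  hermblock (mxEmul a x b) = mxEmul (madj d) (hermblock x) d.
Proof.
rewrite /= (madj_block (madj a)) (madjK hF) !(madj0 hF) mxEmul_diag_block !mxEmulx0.
by rewrite /hermblock (mstar_mxEmul _ _ _ hF star_lin).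
Qed.

(* Unitary equivalence of [0 x; x 0] with diag(x, -x). *)
Lemma sanorm_hermblock n (x : 'M[E]_n) : (0 < n)%N -> selfadj star x ->
  sanorm (hermblock x) = sanorm x.
Proof.
move=> n0 sx; have nn0 : (0 < n + n)%N by rewrite addn_gt0 n0.
pose s := sc_ofR F (Num.sqrt (2^-1)).
have ss : s * s = sc_ofR F 2^-1 by rewrite -(ofRM hF) -expr2 sqr_sqrtr // invr_ge0.
have as2 : abs2 s = 2^-1 by rewrite (abs2_ofR hF) sqr_sqrtr // invr_ge0.
have s_adj : madj (s%:M : 'M[F]_n) = s%:M.
  by rewrite -scalemx1 (madjZ hF) (madj1 hF).
have half2 : mscale (sc_ofR F 2^-1) x + mscale (sc_ofR F 2^-1) x = x.
  apply/matrixP => i j; rewrite !mxE -scalerDl -(ofRD hF).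
  have -> : (2^-1 + 2^-1 : R) = 1 by lra.
  by rewrite (ofR1 hF) scale1r.
(* Block rows of the unitary in question, with [s = 1/sqrt 2]; hence [‖a v‖^2 + ‖b v‖^2 = ‖v‖^2]. *)
pose a : 'M[F]_(n, n + n) := row_mx s%:M s%:M.
pose b : 'M[F]_(n, n + n) := row_mx s%:M (- s%:M).
apply/le_anti/andP; split.
  have -> : hermblock x = mxEmul (madj a) x a + mxEmul (madj b) (- x) b.
    rewrite /a /b !(madj_row, madjN hF) s_adj !mxEmul_col_row.
    rewrite !(mxEmulN, mxEmulNl, mxEmulNr) !mxEmul_scalar ss !opprK.
    by rewrite add_block_mx !subrr half2 /hermblock sx.
  rewrite -[leRHS]mul1r; apply: sanorm_conj2 => //.
  - by rewrite /selfadj mstarN sx.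
  - move=> v; rewrite -[v]vsubmxK !mul_row_col !mulNmx !mul_scalar_mx.
    rewrite (ip_parallelogram hF) !(ipZZ hF) as2 (ip_col hF); lra.
  - by rewrite sanormN.
rewrite -[leRHS]mul1r.
have e : mxEmul (madj (madj a)) (hermblock x) (madj a) = x.
  rewrite (madjK hF) /a madj_row s_adj mxEmul_row_col !mxEmulx0 sx !mxEmul_scalar ss.
  by rewrite add0r addr0 half2.
rewrite -[in leLHS]e; apply: sanorm_conj => //; first exact: selfadj_hermblock.
move=> v; rewrite /a madj_row s_adj mul_col_mx !mul_scalar_mx (ip_col hF) !(ipZZ hF) as2.
lra.
Qed.

(** Removes the case distinction from the norm, so that later estimates concern hermitian blocks
    only. *)
Lemma mnormE n (x : 'M[E]_n) : (0 < n)%N -> mnorm x = sanorm (hermblock x).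
Proof.
by move=> n0; rewrite /Defs.mnorm; case: asboolP => // sx; rewrite sanorm_hermblock.
Qed.

Lemma mnorm_sa n (x : 'M[E]_n) : selfadj star x -> mnorm x = sanorm x.
Proof. by move=> sx; rewrite /Defs.mnorm; case: asboolP. Qed.

Lemma mnorm_ge0 n (x : 'M[E]_n) : (0 < n)%N -> 0 <= mnorm x.
Proof.
move=> n0; rewrite mnormE //; apply: sanorm_ge0; rewrite ?addn_gt0 ?n0 //.
exact: selfadj_hermblock.
Qed.

Lemma mnormD n (x y : 'M[E]_n) : (0 < n)%N -> mnorm (x + y) <= mnorm x + mnorm y.
Proof.
move=> n0; rewrite !mnormE // hermblockD; apply: sanormD; rewrite ?addn_gt0 ?n0 //;
exact: selfadj_hermblock.
Qed.

Lemma ip_diag_block m1 m2 n1 n2 (a : 'M[F]_(m1, n1)) (b : 'M[F]_(m2, n2)) v :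
  let w := block_mx a 0 0 b *m v in
  ip w w = ip (a *m usubmx v) (a *m usubmx v) + ip (b *m dsubmx v) (b *m dsubmx v).
Proof.
by rewrite /= -{1 2}[v]vsubmxK mul_block_col !mul0mx addr0 add0r (ip_col hF).
Qed.

Lemma ip_submx m n (v : 'cV[F]_(m + n)) :
  ip v v = ip (usubmx v) (usubmx v) + ip (dsubmx v) (dsubmx v).
Proof. by rewrite -{1 2}[v]vsubmxK (ip_col hF). Qed.

(** The two bounds together say that [diag(madj a, b)] has squared norm at most [k]. *)
Lemma mnorm_mxEmul_le n m (a : 'M[F]_(m, n)) (x : 'M[E]_n) (b : 'M[F]_(n, m)) k :
  (0 < n)%N -> (0 < m)%N -> 0 <= k ->
  (forall v, ip (madj a *m v) (madj a *m v) <= k * ip v v) ->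
  (forall v, ip (b *m v) (b *m v) <= k * ip v v) ->
  mnorm (mxEmul a x b) <= k * mnorm x.
Proof.
move=> n0 m0 k0 ha hb; rewrite !mnormE // hermblock_mxEmul.
apply: sanorm_conj; rewrite ?addn_gt0 ?n0 ?m0 //; first exact: selfadj_hermblock.
by move=> v; rewrite ip_diag_block (ip_submx v) mulrDr lerD.
Qed.

Lemma mnorm0 n : (0 < n)%N -> mnorm (0 : 'M[E]_n) = 0.
Proof.
move=> n0; apply/le_anti/andP; split; last exact: mnorm_ge0.
have := @mnorm_mxEmul_le n n 0 0 0 0 n0 n0 (lexx _).
rewrite mxEmul0l mul0r (madj0 hF); apply => v; by rewrite mul0mx (ip0r hF) mul0r.
Qed.

(* Rescaling a by s and b by 1/s balances their norms. *)
Lemma mnorm_mxEmul n m (a : 'M[F]_(m, n)) (x : 'M[E]_n) (b : 'M[F]_(n, m)) :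
  (0 < n)%N -> (0 < m)%N -> mnorm (mxEmul a x b) <= opnorm a * mnorm x * opnorm b.
Proof.
move=> n0 m0; have a0 := opnorm_ge0 hF a; have b0 := opnorm_ge0 hF b.
have [ea|na] := eqVneq (opnorm a) 0.
  by rewrite (opnorm_eq0 hF ea) mxEmul0l mnorm0 // !mulr_ge0 ?(opnorm_ge0 hF) ?mnorm_ge0.
have [eb|nb] := eqVneq (opnorm b) 0.
  by rewrite (opnorm_eq0 hF eb) mxEmul0r mnorm0 // !mulr_ge0 ?(opnorm_ge0 hF) ?mnorm_ge0.
set A := opnorm a in a0 na *; set B := opnorm b in b0 nb *.
have Ap : 0 < A by rewrite lt_def na.
have Bp : 0 < B by rewrite lt_def nb.
(* Chosen so that [s A] and [B / s] both equal [sqrt (A B)]. *)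
pose s := Num.sqrt (B / A).
have s2 : s ^+ 2 = B / A by rewrite sqr_sqrtr // divr_ge0.
have s0 : s != 0 by rewrite gt_eqF // sqrtr_gt0 divr_gt0.
have -> : mxEmul a x b = mxEmul (sc_ofR F s *: a) x (sc_ofR F s^-1 *: b).
  apply/matrixP => i j; rewrite !mxE; apply: eq_bigr => k _; apply: eq_bigr => l _.
  by rewrite !mxE mulrACA -(ofRM hF) mulfV // (ofR1 hF) mul1r.
rewrite mulrAC; apply: mnorm_mxEmul_le => //; first exact: mulr_ge0.
  move=> v; rewrite (madjZ hF) -scalemxAl (ipZZ hF) (abs2_ofR hF) s2.
  have -> : A * B = B / A * A ^+ 2 by field.
  rewrite -[leRHS]mulrA ler_wpM2l ?divr_ge0 //.
  apply: (le_trans (opnorm_ub hF _ _)); rewrite ler_wpM2r ?(ip_ge0 hF) //.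
  by rewrite lerXn2r ?nnegrE ?(opnorm_ge0 hF) ?(opnorm_madj hF).
move=> v; rewrite -scalemxAl (ipZZ hF) (abs2_ofR hF) exprVn s2.
have -> : A * B = (B / A)^-1 * B ^+ 2 by field; rewrite na.
rewrite -[leRHS]mulrA ler_wpM2l ?invr_ge0 ?divr_ge0 //.
exact: (opnorm_ub hF).
Qed.

(** Multiplication by scalar matrices gives one inequality; the same inequality for [a^-1] gives the
    other. *)
Lemma mnorm_scale n (a : F) (x : 'M[E]_n) : (0 < n)%N ->
  mnorm (mscale a x) = absF a * mnorm x.
Proof.
move=> n0.
have le c (y : 'M[E]_n) : mnorm (mscale c y) <= absF c * mnorm y.
  rewrite -[c]mulr1 -mxEmul_scalar mulr1.
  apply: (le_trans (mnorm_mxEmul _ _ _ n0 n0)).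
  have o1 : opnorm (1%:M : 'M[F]_n) <= 1.
    apply: (opnorm_lub hF) => // v; by rewrite mul1mx expr1n mul1r.
  rewrite -[leRHS]mulr1; apply: ler_pM => //.
  - by rewrite mulr_ge0 ?(opnorm_ge0 hF) ?mnorm_ge0.
  - exact: (opnorm_ge0 hF).
  - by rewrite ler_wpM2r ?mnorm_ge0 ?(opnorm_scalar hF).
have absE (c : F) : absF c = Num.sqrt (abs2 c) by [].
have absM (c d : F) : absF (c * d) = absF c * absF d.
  by rewrite !absE (abs2M hF) sqrtrM ?(abs2_ge0 hF).
apply/le_anti/andP; split; first exact: le.
have [->|a0] := eqVneq a 0.
  have -> : absF (0 : F) = 0 by rewrite /absF mulr0 (reF0 hF) sqrtr0.
  by rewrite mul0r mnorm_ge0.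
have e : absF a * absF a^-1 = 1.
  by rewrite -absM mulfV // /absF (conjF1 hF) mulr1 -(ofR1 hF) (reF_ofR hF) sqrtr1.
have := le a^-1 (mscale a x).
have -> : mscale a^-1 (mscale a x) = x.
  by apply/matrixP => i j; rewrite !mxE scalerA mulVf // scale1r.
move=> /(ler_wpM2l (sqrtr_ge0 (sc_re (sc_conj a * a)))) /le_trans; apply.
by rewrite -/(absF a) mulrA e mul1r.
Qed.

(** The flip is unitary, so it yields an inequality; applied to [x] and to its adjoint, this is an
    equality. *)
Lemma mnorm_mstar n (x : 'M[E]_n) : (0 < n)%N -> mnorm (mstar star x) = mnorm x.
Proof.
move=> n0; have nn0 : (0 < n + n)%N by rewrite addn_gt0 n0.
have le (y : 'M[E]_n) : mnorm (mstar star y) <= mnorm y.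
  rewrite !mnormE // /hermblock mstarK -mxEmul_swap -[leRHS]mul1r.
  pose u : 'M[F]_(n + n) := block_mx 0 1%:M 1%:M 0.
  have su : madj u = u by rewrite (madj_block 0) !(madj0 hF) (madj1 hF).
  rewrite -/u -{1}su; apply: sanorm_conj => //; first exact: selfadj_hermblock.
  move=> v; rewrite -[v]vsubmxK mul_block_col !mul0mx !mul1mx addr0 add0r.
  by rewrite !(ip_col hF) mul1r addrC.
by apply/le_anti; rewrite le -{1}[x]mstarK le.
Qed.

(** Each summand is a compression by a coordinate isometry, whence the lower bound. Conversely the
    hermitian block of the sum is a sum of two compressions whose squared lengths add up to [‖v‖^2],
    so [sanorm_conj2] applies with [k = 1]. *)
Lemma mnorm_dsum n m (x : 'M[E]_n) (y : 'M[E]_m) : (0 < n)%N -> (0 < m)%N ->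
  mnorm (block_mx x 0 0 y) = Num.max (mnorm x) (mnorm y).
Proof.
move=> n0 m0; have nm0 : (0 < n + m)%N by rewrite addn_gt0 n0.
pose i1 : 'M[F]_(n, n + m) := row_mx 1%:M 0.
pose i2 : 'M[F]_(m, n + m) := row_mx 0 1%:M.
have i1v v : i1 *m v = usubmx v.
  by rewrite -[in LHS](vsubmxK v) mul_row_col mul1mx mul0mx addr0.
have i2v v : i2 *m v = dsubmx v.
  by rewrite -[in LHS](vsubmxK v) mul_row_col mul1mx mul0mx add0r.
have a1 : madj i1 = col_mx 1%:M 0 by rewrite madj_row (madj1 hF) (madj0 hF).
have a2 : madj i2 = col_mx 0 1%:M by rewrite madj_row (madj1 hF) (madj0 hF).
apply/le_anti/andP; split; last first.
  rewrite ge_max; apply/andP; split.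
    have {1}-> : x = mxEmul i1 (block_mx x 0 0 y) (madj i1).
      by rewrite a1 mxEmul_row_col mxEmul1 !mxEmulx0 mxEmul0r !addr0.
    rewrite -[leRHS]mul1r; apply: mnorm_mxEmul_le => // v;
      by rewrite a1 mul_col_mx mul1mx mul0mx (ip_col hF) (ip0r hF) addr0 mul1r.
  have {1}-> : y = mxEmul i2 (block_mx x 0 0 y) (madj i2).
    by rewrite a2 mxEmul_row_col mxEmul1 !mxEmulx0 mxEmul0r !add0r.
  rewrite -[leRHS]mul1r; apply: mnorm_mxEmul_le => // v;
    by rewrite a2 mul_col_mx mul1mx mul0mx (ip_col hF) (ip0r hF) add0r mul1r.
rewrite (mnormE (block_mx x 0 0 y)) //.
have -> : block_mx x 0 0 y = mxEmul (madj i1) x i1 + mxEmul (madj i2) y i2.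
  rewrite a1 a2 !mxEmul_col_row !mxEmul1 !mxEmul0l !mxEmul0r add_block_mx.
  by rewrite !(addr0, add0r).
rewrite hermblockD !hermblock_mxEmul !(madjK hF) -[leRHS]mul1r.
apply: sanorm_conj2; rewrite ?addn_gt0 ?n0 ?m0 //; try exact: selfadj_hermblock.
- move=> v; rewrite !ip_diag_block !i1v !i2v mul1r.
  by rewrite (ip_submx v) (ip_submx (usubmx v)) (ip_submx (dsubmx v)) addrACA.
- by rewrite -mnormE // le_max lexx.
- by rewrite -mnormE // le_max lexx orbT.
Qed.

Lemma opnorm_ampl_le n (x : 'M[E]_n) : (0 < n)%N -> opnorm (fm x) <= mnorm x.
Proof.
move=> n0; have nn0 : (0 < n + n)%N by rewrite addn_gt0 n0.
rewrite mnormE //.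
apply: le_trans (opnorm_ampl_le_sanorm nn0 (selfadj_hermblock x)).
apply: (opnorm_lub hF); first exact: (opnorm_ge0 hF).
(* On [col_mx 0 v] the matrix of the block has upper component [fm x *m v]. *)
move=> v; have := opnorm_ub hF (fm (hermblock x)) (col_mx 0 v).
rewrite {1 2}/ampl /hermblock map_block_mx mul_block_col !mulmx0 !add0r.
rewrite !(ip_col hF) (ip0r hF) add0r; apply: le_trans.
by rewrite lerDl (ip_ge0 hF).
Qed.

(** The decomposition [x - 0] attains the lower bound given by contractivity of [f1]. *)
Lemma mnorm_pos n (x : 'M[E]_n) : (0 < n)%N -> C x -> mnorm x = opnorm (fm x).
Proof.
move=> n0 Cx; apply/le_anti; rewrite opnorm_ampl_le // andbT.
rewrite mnorm_sa; last exact: C_sa.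
rewrite -[in leLHS](subr0 x); apply: sanorm_ub => //; first exact: C0.
  exact: (opnorm_ge0 hF).
by move=> v; rewrite addr0; apply: (quad_le_opnorm hF).
Qed.

(** * Decomposition of the selfadjoint unit ball *)

Lemma posdef_factor n (y : 'M[E]_n) : (0 < n)%N -> C y -> posdef (fm y) ->
  exists c k, [/\ psd c, C k, fm k = 1%:M, c *m c = fm y & y = mxEmul c k c].
Proof.
move=> n0 Cy py; have [c pc cc] := posdef_sqrt hF py.
have cu := posdef_unit hF pc; have [sc _] := pc.
have sci : madj (invmx c) = invmx c.
  have h : madj (invmx c) *m c = 1%:M by rewrite -{2}sc -(madjM hF) mulmxV // (madj1 hF).
  by rewrite -[LHS]mulmx1 -(mulmxV cu) mulmxA h mul1mx.
(* Compression by the inverse root normalises the matrix of [y] to the identity. *)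
exists c, (mxEmul (invmx c) y (invmx c)); split=> //.
- exact: posdef_psd.
- by rewrite -{1}sci; exact: C_conj.
- by rewrite (ampl_mxEmul _ _ _ f1_lin) -cc mulmxA mulVmx // mul1mx mulmxV.
- by rewrite mxEmulA mulmxV // mulVmx // mxEmul1.
Qed.

Lemma sa_ball_decomposition n (t : R) (x k : 'M[E]_n) : (0 < n)%N ->
  C k -> fm k = 1%:M -> selfadj star x -> sanorm x < t ->
  exists c1 c2 : 'M[F]_n, exists x1 x2,
    [/\ psd c1, psd c2, psd ((sc_ofR F t)%:M - c1 *m c1 - c2 *m c2),
        (C x1 /\ fm x1 = 1%:M) /\ (C x2 /\ fm x2 = 1%:M)
      & x = mxEmul c1 x1 c1 - mxEmul c2 x2 c2].
Proof.
move=> n0 Ck fk sx lt.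
(* [s] leaves room on both sides, and [s + 2 e = t]: adding [e k] to both parts uses up exactly the
   gap. *)
pose s := (sanorm x + t) / 2; pose e := (t - s) / 2.
have e0 : 0 < e by rewrite /e /s; lra.
have [|y [z [Cy Cz ex _ q]]] := @sanorm_lt _ x s n0 sx; first by rewrite /s; lra.
(* [e k] is written as a compression by the scalar [r], which keeps it in the cone. *)
pose r := sc_ofR F (Num.sqrt e).
have rr : r * r = sc_ofR F e by rewrite -(ofRM hF) -expr2 sqr_sqrtr // ltW.
have r_adj : madj (r%:M : 'M[F]_n) = r%:M.
  by rewrite -scalemx1 (madjZ hF) (madj1 hF).
pose ek := mxEmul (r%:M : 'M[F]_n) k r%:M.
have Cek : C ek by rewrite /ek -{1}r_adj; exact: C_conj.
have fek : fm ek = (sc_ofR F e)%:M.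
  by rewrite (ampl_mxEmul _ _ _ f1_lin) fk mulmx1 -scalar_mxM rr.
have pd w : C w -> posdef (fm (w + ek)).
  move=> Cw; have Cwe : C (w + ek) by exact: CD.
  split=> [|v v0]; first by apply: madj_ampl; exact: C_sa.
  rewrite amplD fek mulmxDl mul_scalar_mx (ipDr hF) (ipZr hF).
  by rewrite ltr_wpDl ?ampl_quad_ge0 // mulr_gt0 // (ip_gt0 hF).
have [c1 [x1 [p1 C1 k1 cc1 e1]]] := posdef_factor n0 (CD n0 Cy Cek) (pd _ Cy).
have [c2 [x2 [p2 C2 k2 cc2 e2]]] := posdef_factor n0 (CD n0 Cz Cek) (pd _ Cz).
exists c1, c2, x1, x2; split=> //; last first.
  by rewrite -e1 -e2 ex opprD addrACA subrr addr0.
have [s1 _] := p1; have [s2 _] := p2.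
apply: (psdP hF).
  rewrite !(madjD hF) !(madjN hF) !(madjM hF) s1 s2.
  by rewrite -scalemx1 (madjZ hF) (madj1 hF).
(* The two squares add up to the matrix of [y + z] plus [2 e I], whose form is at most
   [(s + 2 e) ‖v‖^2]. *)
move=> v; rewrite cc1 cc2 !amplD fek.
rewrite !mulmxBl !mulmxDl !mul_scalar_mx !(ipDr hF) !(ipNr hF) !(ipDr hF) !(ipZr hF).
have := q v; rewrite amplD mulmxDl (ipDr hF).
have -> : s = t - 2 * e by rewrite /e; lra.
rewrite mulrBl; lra.
Qed.

End BaseNorm.

Theorem theorem4p4 (R : realType) (F : scalars R) (E : lmodType F)
  (star : E -> E) (C : forall n, set 'M[E]_n) (K : forall n, set 'M[E]_n)
  (f1 : E -> F) :
  is_RC F ->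
  (* E is a *-vector space *)
  (forall e : E, star (star e) = e) ->
  (forall (a : F) (e e' : E),
      star (a *: e + e') = sc_conj a *: star e + star e') ->
  (* matrix ordered space: proper cones in M_n(E)_sa, compatible *)
  (forall n, (0 < n)%N ->
     [/\ C n 0,
         (forall x y, C n x -> C n y -> C n (x + y)),
         (forall (t : R) x, 0 <= t -> C n x -> C n (mscale (sc_ofR F t) x)),
         (forall x, C n x -> selfadj star x)
       & (forall x, C n x -> C n (- x) -> x = 0)]) ->
  (forall n m (alpha : 'M[F]_(n, m)) x, (0 < n)%N -> (0 < m)%N ->
     C n x -> C m (mxEmul (madj alpha) x alpha)) ->
  (* K is a matrix convex set *)
  (forall n m x y, (0 < n)%N -> (0 < m)%N -> K n x -> K m y ->
     K (n + m)%N (block_mx x 0 0 y)) ->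
  (forall n m (a : 'M[F]_(n, m)) x, (0 < n)%N -> (0 < m)%N ->
     madj a *m a = 1%:M -> K n x -> K m (mxEmul (madj a) x a)) ->
  (* f1 is a strictly positive selfadjoint linear functional *)
  (forall (a : F) (e e' : E), f1 (a *: e + e') = a * f1 e + f1 e') ->
  (forall e : E, f1 (star e) = sc_conj (f1 e)) ->
  (forall x : 'M[E]_1, C 1%N x -> x <> 0 -> 0 < f1 (x 0 0)) ->
  (* (a) *)
  (forall n, (0 < n)%N ->
     K n = (fun x : 'M[E]_n => C n x /\ ampl f1 x = 1%:M)) ->
  (* (b) *)
  (forall n (x : 'M[E]_n), (0 < n)%N -> selfadj star x ->
     exists t : R, exists k, 0 < t /\ K n k /\
       C n (mscale (sc_ofR F t) k - x)) ->
  (* (c) *)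
  (forall n (x : 'M[E]_n), (0 < n)%N -> selfadj star x ->
     (forall eps : R, 0 < eps -> exists y z,
        [/\ C n y, C n z, x = y - z,
            opnorm (ampl f1 y) < eps & opnorm (ampl f1 z) < eps]) ->
     x = 0) ->
  let N := @mnorm R F E star C f1 in
  (* the ||.||_n are norms on M_n(E) *)
  (forall n (x y : 'M[E]_n) (a : F), (0 < n)%N ->
     [/\ 0 <= N n x, (N n x = 0 -> x = 0),
         N n (mscale a x) = absF a * N n x
       & N n (x + y) <= N n x + N n y]) /\
  (* Ruan's axioms: E is an operator space *)
  (forall n m (x : 'M[E]_n) (y : 'M[E]_m), (0 < n)%N -> (0 < m)%N ->
     N (n + m)%N (block_mx x 0 0 y) = Num.max (N n x) (N m y)) /\
  (forall n m (alpha : 'M[F]_(m, n)) (x : 'M[E]_n) (beta : 'M[F]_(n, m)),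
     (0 < n)%N -> (0 < m)%N ->
     N m (mxEmul alpha x beta) <= opnorm alpha * N n x * opnorm beta) /\
  (* matrix ordered matrix normed *-vector space (up to closedness) *)
  (forall n (x : 'M[E]_n), (0 < n)%N -> N n (mstar star x) = N n x) /\
  (* K_n lies in Ball(M_n(E))_+ *)
  (forall n x, (0 < n)%N -> K n x -> C n x /\ N n x <= 1) /\
  (* f1 is completely contractive *)
  (forall n (x : 'M[E]_n), (0 < n)%N -> opnorm (ampl f1 x) <= N n x) /\
  (* ||x||_n = ||f1^(n)(x)|| on the positive cone *)
  (forall n (x : 'M[E]_n), (0 < n)%N -> C n x ->
     N n x = opnorm (ampl f1 x)) /\
  (* condition 3) of a nc base norm space *)
  (forall n (t : R) (x : 'M[E]_n), (0 < n)%N -> 1 < t ->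
     selfadj star x -> N n x <= 1 ->
     exists c1 c2 : 'M[F]_n, exists x1 x2,
       [/\ psd c1, psd c2,
           psd ((sc_ofR F t)%:M - c1 *m c1 - c2 *m c2),
           K n x1 /\ K n x2
         & x = mxEmul c1 x1 c1 - mxEmul c2 x2 c2]).

Proof.
move=> hF starK star_lin Cone C_conj Kdsum Kconj f1_lin f1_star f1_pos Ka Kb Kc N.
have C0 n : (0 < n)%N -> C n 0 by move=> /Cone[].
have CD n (x y : 'M[E]_n) : (0 < n)%N -> C n x -> C n y -> C n (x + y).
  by move=> /Cone[_ + _ _ _]; exact.
have CZ n (t : R) (x : 'M[E]_n) : (0 < n)%N -> 0 <= t -> C n x ->
    C n (mscale (sc_ofR F t) x).
  by move=> /Cone[_ _ + _ _]; exact.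
have C_sa n (x : 'M[E]_n) : (0 < n)%N -> C n x -> selfadj star x.
  by move=> /Cone[_ _ _ + _]; exact.
have KP n (x : 'M[E]_n) : (0 < n)%N -> K n x -> C n x /\ ampl f1 x = 1%:M.
  by move=> n0; rewrite Ka.
(* From (b), with [t k] as the dominating cone element. *)
have C_gen n (x : 'M[E]_n) : (0 < n)%N -> selfadj star x ->
    exists2 y, C n y & C n (y - x).
  move=> n0 sx; have [t [k [t0 [/KP[]// Ck _ Cx]]]] := Kb n x n0 sx.
  by exists (mscale (sc_ofR F t) k) => //; apply: CZ => //; exact: ltW.
have sa0 n : (0 < n)%N -> selfadj star (0 : 'M[E]_n) by move=> n0; apply/C_sa/C0.
split.
  move=> n x y a n0; split.
  - exact: mnorm_ge0.
  (* Hypothesis (c) is applied at level [n + n] to the hermitian block, and [x] is read off from its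
     upper right corner. *)
  - rewrite /N (mnormE (C := C)) // => h0.
    have nn0 : (0 < n + n)%N by rewrite addn_gt0 n0.
    have sH := selfadj_hermblock hF starK star_lin x.
    have h := sanorm_eq0 hF C_sa C_conj f1_lin f1_star f1_pos C_gen nn0 sH h0.
    have /eqP := Kc _ _ nn0 sH h.
    by rewrite block_mx_eq0 => /and4P[_ /eqP].
  - exact: mnorm_scale.
  - exact: mnormD.
split; first by move=> n m x y n0 m0; exact: mnorm_dsum.
split; first by move=> n m a x b n0 m0; exact: mnorm_mxEmul.
split; first by move=> n x n0; exact: mnorm_mstar.
split.
  move=> n x n0 /(KP _ _ n0)[Cx fx]; split=> //.
  rewrite /N (mnorm_pos (C := C)) // fx.
  by apply: (opnorm_lub hF) => // v; rewrite mul1mx expr1n mul1r.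
split; first by move=> n x n0; exact: opnorm_ampl_le.
split; first by move=> n x n0 Cx; exact: mnorm_pos.
move=> n t x n0 t1 sx; rewrite /N mnorm_sa // => hx.
(* Applying (b) to [0] shows that [K n] is nonempty; [k] drives the perturbation. *)
have [_ [k [_ [/KP[]// Ck fk _]]]] := Kb n 0 n0 (sa0 n n0).
rewrite Ka //.
have lt : sanorm C f1 x < t by exact: le_lt_trans t1.
exact: (sa_ball_decomposition hF CD C_sa C_conj f1_lin f1_star f1_pos C_gen n0 Ck
  fk sx lt).
Qed.
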